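(* Let $\mathcal{B}_n$ be the number of graphical bridges of length $2n$, and let $\mathcal{B}_n^*$ be the L\'evy--Khintchine transform of $\mathcal{B}_n$. Then, for all $n\geqslant1$, \[ \mathcal{B}_n^*=2\mathcal{T}_n, \] where $\mathcal{T}_n$ is the number of rooted unlabeled (cyclically distinct) plane trees with $n$ edges.
   Context: A bridge of length $2n$ is a sequence $B=(B_0,B_1,\ldots,B_{2n})$ of integers with $B_0=B_{2n}=0$ and all increments $B_i-B_{i-1}\in\{+1,-1\}$. For a walk $X=(X_0,\ldots,X_{2k})$ with $\pm1$ increments, its diamond area is $\sigma(X)=\frac12\sum_{i=1}^kX_{2i}$. For $B$ a bridge of length $2n$, write $B^{(2k)}=(B_0,\ldots,B_{2k})$. The bridge $B$ is graphical if $\sigma(B)=0$ and $\sigma(B^{(2k)})\geqslant0$ for all $1\leqslant k<n$. By convention $\mathcal{B}_0=1$. The L\'evy--Khintchine transform $(A_n^* )_{n\geqslant1}$ of a sequence $(A_n)_{n\geqslant0}$ with $A_0=1$ is the sequence determined by the identity (of power series) \[ \sum_{n=0}^\infty A_nx^n=\exp\left(\sum_{k=1}^\infty\frac{A_k^*}{k}x^k\right), \] or equivalently by the recursion $nA_n=\sum_{i=1}^nA_i^*A_{n-i}$ for all $n\geqslant1$. $\mathcal{T}_n$ ($n\geqslant1$) is the number of unlabeled plane trees with $n$ edges and a distinguished root vertex, where two such trees are identified if there is a root-preserving isomorphism preserving the cyclic order of edges around each vertex (in particular the subtrees at the root are only ordered cyclically). By Walkup's formula, $\mathcal{T}_n=\frac1n\sum_{d\mid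 n}\binom{2d-1}{d}\phi(n/d)$, where $\phi$ is Euler's totient function. By von Sterneck's subset counting formulas, $\mathcal{T}_n$ is also the number of submultisets of $\{0,1,\ldots,n-1\}$ of size $n$ (repetitions allowed) whose sum is $0$ mod $n$. *)

(* Defs.v *)
From HB Require Import structures.
From mathcomp Require Import all_boot all_order all_algebra all_fingroup.
From mathcomp Require Import ring.
Set Implicit Arguments. Unset Strict Implicit. Unset Printing Implicit Defensive.
Import Order.TTheory GRing.Theory Num.Theory.
Local Open Scope ring_scope.

(* A walk started at 0 is encoded by its increments: [true] is +1, [false] is
   -1, and [walk s i] is its position after [i] steps. *)
Definition walk m (s : {ffun 'I_m -> bool}) (i : nat) : int :=
  \sum_(j < m | (j < i)%N) (if s j then 1 else -1).

Definition is_bridge n (s : {ffun 'I_(2 * n) -> bool}) : bool :=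
  walk s (2 * n) == 0.

(* The diamond area of (X_0, ..., X_2k). *)
Definition diamond_area (X : nat -> int) (k : nat) : rat :=
  (\sum_(1 <= i < k.+1) X (2 * i)%N)%:~R / 2.

Definition is_graphical n (s : {ffun 'I_(2 * n) -> bool}) : bool :=
  (diamond_area (walk s) n == 0) &&
  [forall k : 'I_n, (1 <= k)%N ==> (0 <= diamond_area (walk s) k)].

Definition num_graphical_bridges (n : nat) : nat :=
  #|[set s : {ffun 'I_(2 * n) -> bool} | is_bridge s && is_graphical s]|.

Lemma num_graphical_bridges0 : num_graphical_bridges 0 = 1%N.
Proof.
rewrite /num_graphical_bridges (_ : [set _ | _] = setT); last first.
  apply/setP => s; rewrite !inE /is_bridge /is_graphical /walk /diamond_area.
  rewrite big_pred0 => [|j]; last by rewrite ltn0.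
  rewrite eqxx big_geq // mul0r eqxx /=; apply/forallP; by case.
by rewrite cardsT card_ffun card_bool card_ord muln0.
Qed.

(* [levy_khintchine A a] is the identity of formal power series
     sum_(n >= 0) A_n x^n = exp (sum_(k >= 1) (a_k / k) x^k)
   read coefficient by coefficient.  The series inside exp has no constant
   term, so the coefficient of x^n only involves its terms of degree at most n
   and the terms of exp of order at most n.  Only the values a_k with k >= 1
   occur; they are determined by A, and exist as soon as A_0 = 1. *)
Definition levy_khintchine (A a : nat -> rat) : Prop :=
  forall n : nat,
    A n = (\sum_(j < n.+1)
             (j`!%:R)^-1 *:
               (\sum_(1 <= k < n.+1) (a k / k%:R) *: 'X^k) ^+ j)`_n.

Lemma levy_khintchine_recursion (A a : nat -> rat) :
  levy_khintchine A a <->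
  A 0%N = 1 /\
  forall n, (1 <= n)%N -> n%:R * A n = \sum_(1 <= i < n.+1) a i * A (n - i)%N.
Proof.
pose f N : {poly rat} := \sum_(1 <= k < N.+1) (a k / k%:R) *: 'X^k.
pose E N m : {poly rat} := \sum_(j < m.+1) (j`!%:R)^-1 *: f N ^+ j.
have fS N : exists g, f N = 'X * g.
  rewrite /f; elim: N => [|N [g IH]]; first by exists 0; rewrite big_geq ?mulr0.
  rewrite big_nat_recr //= IH exprS scalerAr -mulrDr; by eexists.
have fD N m : exists g, f (N + m)%N = f N + 'X^(N.+1) * g.
  elim: m => [|m [g IH]]; first by exists 0; rewrite addn0 mulr0 addr0.
  rewrite /f addnS big_nat_recr //= -/(f _) IH -addSn exprD.
  by rewrite scalerAr -addrA -mulrDr; eexists.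
have fXD N m j : exists g, f (N + m)%N ^+ j = f N ^+ j + 'X^(N.+1) * g.
  have [g ->] := fD N m; elim: j => [|j [u IH]].
    by exists 0; rewrite !expr0 mulr0 addr0.
  exists (f N * u + g * f N ^+ j + g * ('X^(N.+1) * u)).
  rewrite !(exprS _ j) IH; move: (f N) (f N ^+ j) 'X^_ => F G X; ring.
have stable n p m : (E (n + p) (n + m))%N`_n = (E n n)`_n.
  elim: m => [|m IH].
    rewrite addn0 /E !coef_sum; apply: eq_bigr => j _; rewrite !coefZ.
    by have [g ->] := fXD n p j; rewrite coefD coefXnM ltnSn addr0.
  rewrite /E addnS big_ord_recr /= coefD IH coefZ.
  have [g ->] := fS (n + p)%N.
  by rewrite exprMn -addSn exprD -mulrA coefXnM ltnSn mulr0 addr0.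
have dE N m : (E N m.+1)^`() = (f N)^`() * E N m.
  rewrite /E raddf_sum /= big_ord_recl expr0 derivZ -polyC1 derivC scaler0 add0r.
  rewrite mulr_sumr; apply: eq_bigr => j _.
  rewrite derivZ deriv_exp /= /bump /= add0n add1n /=.
  rewrite -scaler_nat scalerA -scalerAr factS natrM invfM mulrAC mulVf ?mul1r //.
  by rewrite pnatr_eq0.
have coef_f N i : (1 <= i <= N)%N -> (f N)`_i = a i / i%:R.
  move=> iN; rewrite /f coef_sum (bigD1_seq i) ?mem_index_iota ?iota_uniq //=.
  rewrite coefZ coefXn eqxx mulr1 big1 ?addr0 // => k ki.
  by rewrite coefZ coefXn eq_sym (negPf ki) mulr0.
pose e n := (E n n)`_n.
have e_rec n : (1 <= n)%N ->
    n%:R * e n = \sum_(1 <= i < n.+1) a i * e (n - i)%N.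
  case: n => // n _; have := congr1 (fun p : {poly rat} => p`_n) (dE n.+1 n).
  rewrite coef_deriv mulr_natl => ->.
  rewrite coefM big_add1 big_mkord; apply: eq_bigr => i _.
  have in_n : (i <= n)%N by rewrite -ltnS.
  rewrite coef_deriv coef_f ?ltn_ord // -[(_ / _) *+ _]mulr_natr divfK ?pnatr_eq0 //.
  rewrite subSS; congr (_ * _).
  have := stable (n - i)%N i.+1 i; rewrite addnS !subnK // => ->.
have e0 : e 0%N = 1.
  by rewrite /e /E big_ord1 expr0 fact0 invr1 scale1r coef1.
split=> [AE | [A0 Arec]].
  have Ae n : A n = e n by rewrite AE.
  split=> [|n n_gt0]; first by rewrite Ae e0.
  rewrite Ae e_rec //; apply: eq_bigr => i _; by rewrite Ae.
elim/ltn_ind=> -[|n] IH; first exact: etrans A0 (esym e0).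
have n0 : n.+1%:R != 0 :> rat by rewrite pnatr_eq0.
apply: (mulfI n0); rewrite Arec // -[RHS]/(n.+1%:R * e n.+1) e_rec //.
apply: eq_big_nat => i /andP[i_gt0 _]; congr (_ * _).
by apply: IH; rewrite ltn_subrL i_gt0.
Qed.

Lemma levy_khintchine_exists (A : nat -> rat) :
  A 0%N = 1 -> exists a, levy_khintchine A a.
Proof.
move=> A0.
pose next s : seq rat := rcons s
  ((size s)%:R * A (size s) - \sum_(1 <= i < size s) s`_i * A (size s - i)%N).
pose s n := iter n next [::]; pose a n := (s n.+1)`_n.
have size_s n : size (s n) = n by elim: n => //= n IH; rewrite size_rcons IH.
have nth_s n i : (i < n)%N -> (s n)`_i = a i.
  elim: n => // n IH; rewrite ltnS leq_eqVlt => /predU1P[-> // | i_n].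
  by rewrite -IH //= nth_rcons size_s i_n.
exists a; apply/levy_khintchine_recursion; split=> // n n_gt0.
rewrite big_nat_recr //= subnn A0 mulr1 {2}/a /= nth_rcons size_s ltnn eqxx.
rewrite addrC -addrA -[LHS]addr0; congr (_ + _).
apply/esym/eqP; rewrite addrC subr_eq0; apply/eqP; apply: eq_big_nat => i.
by case/andP=> _ i_n; rewrite nth_s.
Qed.

Lemma levy_khintchine_unique (A a b : nat -> rat) :
  levy_khintchine A a -> levy_khintchine A b ->
  forall n, (1 <= n)%N -> a n = b n.
Proof.
move=> /levy_khintchine_recursion[A0 Aa] /levy_khintchine_recursion[_ Ab].
elim/ltn_ind=> n IH n_gt0; have := Aa n n_gt0; rewrite Ab //.
rewrite !big_nat_recr //= subnn A0 !mulr1.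
rewrite (eq_big_nat _ _ (F2 := fun i => a i * A (n - i)%N)) => [/addrI // |i].
by case/andP=> i_gt0 i_n; rewrite IH.
Qed.

(* A plane tree with n edges and a distinguished root, on the vertex set
   {0, ..., n}: a set of edges, a rotation system giving at each vertex the
   successor of each of its neighbours in the cyclic order around it, and the
   root.  The cyclic orders determine the embedding of a tree in the oriented
   plane up to homeomorphism. *)
Definition plane_structure (n : nat) : finType :=
  ({set {set 'I_n.+1}} * {ffun 'I_n.+1 -> {perm 'I_n.+1}} * 'I_n.+1)%type.

Definition edges n (t : plane_structure n) : {set {set 'I_n.+1}} := t.1.1.
Definition rotation n (t : plane_structure n) (x : 'I_n.+1) :
  {perm 'I_n.+1} := t.1.2 x.
Definition root_vertex n (t : plane_structure n) : 'I_n.+1 := t.2.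

Definition adjacent n (t : plane_structure n) : rel 'I_n.+1 :=
  [rel x y | [set x; y] \in edges t].
Definition neighbours n (t : plane_structure n) (x : 'I_n.+1) :
  {set 'I_n.+1} := [set y | adjacent t x y].

(* Connected, with n + 1 vertices and n edges. *)
Definition is_tree n (t : plane_structure n) : bool :=
  [&& [forall e in edges t, #|e| == 2],
      [forall x, forall y, connect (adjacent t) x y]
    & #|edges t| == n].

(* [rotation t x] is a single cycle on the neighbours of x (and, so that it
   carries no further data, the identity elsewhere). *)
Definition is_rotation_system n (t : plane_structure n) : bool :=
  [forall x, perm_on (neighbours t x) (rotation t x) &&
     [forall y in neighbours t x,
        porbit (rotation t x) y == neighbours t x]].

Definition is_plane_tree n (t : plane_structure n) : bool :=
  is_tree t && is_rotation_system t.

Definition plane_iso n (t u : plane_structure n) : bool :=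
  [exists h : {perm 'I_n.+1},
     [&& h (root_vertex t) == root_vertex u,
         [forall x, forall y, adjacent u (h x) (h y) == adjacent t x y]
       & [forall x, forall y in neighbours t x,
            h (rotation t x y) == rotation u (h x) (h y)]]].

Lemma plane_isoP n (t u : plane_structure n) :
  reflect (exists h : {perm 'I_n.+1},
    [/\ h (root_vertex t) = root_vertex u,
        forall x y, adjacent u (h x) (h y) = adjacent t x y
      & forall x y, adjacent t x y ->
          h (rotation t x y) = rotation u (h x) (h y)])
    (plane_iso t u).
Proof.
apply: (iffP existsP) => -[h] => [/and3P[/eqP hr ha hs] | [hr ha hs]]; exists h.
  split=> // [x y | x y xy].
    by move/forallP/(_ x)/forallP/(_ y)/eqP: ha.
  by move/forallP/(_ x)/forall_inP/(_ y): hs; rewrite inE => /(_ xy)/eqP.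
apply/and3P; split; first exact/eqP.
  by apply/forallP => x; apply/forallP => y; apply/eqP.
by apply/forallP => x; apply/forall_inP => y; rewrite inE => xy; apply/eqP/hs.
Qed.

Lemma plane_iso_equivalence n : equivalence_rel (@plane_iso n).
Proof.
have isoxx t : plane_iso t t.
  by apply/plane_isoP; exists 1%g; split=> *; rewrite !perm1.
have isoC t u : plane_iso t u -> plane_iso u t.
  case/plane_isoP=> h [hr ha hs]; apply/plane_isoP; exists h^-1%g.
  split=> [|x y|x y xy]; first by rewrite -hr permK.
    by rewrite -ha !permKV.
  by apply: (@perm_inj _ h); rewrite hs -?ha !permKV.
have isoT t u v : plane_iso t u -> plane_iso u v -> plane_iso t v.
  case/plane_isoP=> h [hr ha hs] /plane_isoP[k [kr ka ks]]; apply/plane_isoP.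
  exists (h * k)%g; split=> [|x y|x y xy]; rewrite !permM ?hr ?ka ?hs //.
  by rewrite ks // ha.
move=> t u v; split=> // tu; apply/idP/idP; last exact: isoT.
by apply: isoT; apply: isoC.
Qed.

(* Unlabelled trees are isomorphism classes of labelled ones. *)
Definition num_plane_trees (n : nat) : nat :=
  #|equivalence_partition (@plane_iso n) [set t | is_plane_tree t]|.

(* Main.v *)
(* Observed at even times and halved, a bridge of length 2n is a lazy bridge of
   length n, whose area is the diamond area.  Call a renewal a time at which both
   the walk and its area vanish.  Marking one of the n times of a graphical bridge
   and cutting at the last renewal before it gives
     n B_n = sum_i B_(n-i) N_i,
   where N_i counts the graphical bridges of length i with a time marked before
   their first positive renewal.  Rotating to the marked time turns these into the
   bridges of length i whose area is divisible by i, so N = B^* by the recursion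
   for the transform.  A roots of unity filter and Burnside's lemma show that N_n
   is twice the number of binary necklaces with n beads of each colour.  Finally,
   recording whether each step of the contour walk of a plane tree leaves or
   approaches the root is a bijection from rooted plane trees to these necklaces;
   the root is where the cyclic walk of the necklace is lowest. *)
Require Import Defs.
From mathcomp Require Import all_boot all_order all_algebra all_fingroup.
From mathcomp Require Import algC cyclotomic zify ring.
Import Order.TTheory GRing.Theory Num.Theory.
Local Open Scope ring_scope.

Set Implicit Arguments. Unset Strict Implicit. Unset Printing Implicit Defensive.

(** * Area of lazy walks *)

(** Divisibility appears because starting a closed lazy walk of length n at time k changes its area
    by -n times the height at k. A rotation of area zero therefore needs the area to be n times some
    height s, and must start at height s. Conversely, the recentred area is minimal where the walk
    crosses s, and it cannot jump over s since its steps are -1, 0 or 1. The factor 2 comes from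
    comparing two evaluations of the sum over k < n of binomials C(2g, g) with g = gcd(k, n). The
    filter gives n times the number of bridges. Burnside's lemma averages over all 2n rotations, of
    which only the n even ones contribute, and gives 2n times the number of necklaces. On the side
    of trees the obstacle is that the edges at the root are only cyclically ordered, so that a
    contour walk has no canonical first step. A code is therefore a relation between trees and
    words, and uniqueness is only up to rotation. *)

Definition psum (g : nat -> int) (k : nat) : int := \sum_(i < k) g i.
Definition area (g : nat -> int) (k : nat) : int := \sum_(i < k) psum g i.+1.
Definition shift (a : nat) (g : nat -> int) (j : nat) : int := g (a + j)%N.

Definition renewal (g : nat -> int) (k : nat) : bool :=
  (psum g k == 0) && (area g k == 0).
Definition graphical (n : nat) (g : nat -> int) : bool :=
  renewal g n && [forall k : 'I_n, 0 <= area g k].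

Lemma psumS g k : psum g k.+1 = psum g k + g k.
Proof. by rewrite /psum big_ord_recr. Qed.

Lemma areaS g k : area g k.+1 = area g k + psum g k.+1.
Proof. by rewrite /area big_ord_recr. Qed.

Lemma psum0 g : psum g 0 = 0.
Proof. by rewrite /psum big_ord0. Qed.

Lemma area0 g : area g 0 = 0.
Proof. by rewrite /area big_ord0. Qed.

Lemma psumD g a k : psum g (a + k) = psum g a + psum (shift a g) k.
Proof.
elim: k => [|k IH]; first by rewrite addn0 psum0 addr0.
by rewrite addnS !psumS IH addrA.
Qed.

Lemma areaD g a k :
  area g (a + k) = area g a + psum g a *+ k + area (shift a g) k.
Proof.
elim: k => [|k IH]; first by rewrite addn0 mulr0n area0 !addr0.
by rewrite addnS !areaS IH -addnS psumD mulrS; ring.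
Qed.

Lemma eq_psum g h n k : (forall j, (j < n)%N -> g j = h j) -> (k <= n)%N ->
  psum g k = psum h k.
Proof. by move=> gh kn; apply: eq_bigr => i _; apply: gh; apply: leq_trans kn. Qed.

Lemma eq_area g h n k : (forall j, (j < n)%N -> g j = h j) -> (k <= n)%N ->
  area g k = area h k.
Proof.
move=> gh kn; apply: eq_bigr => i _; apply: (eq_psum gh).
by apply: leq_trans kn.
Qed.

Lemma eq_renewal g h n k : (forall j, (j < n)%N -> g j = h j) -> (k <= n)%N ->
  renewal g k = renewal h k.
Proof. by move=> gh kn; rewrite /renewal (eq_psum gh) // (eq_area gh). Qed.

Lemma eq_graphical g h n : (forall j, (j < n)%N -> g j = h j) ->
  graphical n g = graphical n h.
Proof.
move=> gh; rewrite /graphical (eq_renewal gh) //; congr (_ && _).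
by apply: eq_forallb => k; rewrite (eq_area gh) // ltnW.
Qed.

Lemma renewal0 g : renewal g 0.
Proof. by rewrite /renewal psum0 area0 eqxx. Qed.

Lemma renewalD g a k : renewal g a -> renewal g (a + k) = renewal (shift a g) k.
Proof.
by case/andP=> /eqP Pa /eqP Aa; rewrite /renewal psumD areaD Pa Aa mul0rn !add0r.
Qed.

Lemma graphicalP n g : reflect
  [/\ renewal g n & forall k, (k < n)%N -> 0 <= area g k] (graphical n g).
Proof.
apply: (iffP andP) => -[rn H]; split=> //.
  by move=> k kn; move/forallP: H => /(_ (Ordinal kn)).
by apply/forallP => k; apply: H.
Qed.

Lemma graphicalD a b g : renewal g a ->
  graphical (a + b) g = graphical a g && graphical b (shift a g).
Proof.
move=> ra; have := ra; case/andP=> /eqP Pa /eqP Aa.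
have AE k : area g (a + k) = area (shift a g) k by rewrite areaD Pa Aa mul0rn !add0r.
apply/graphicalP/andP => [[rab H]|[/graphicalP[_ Ha] /graphicalP[rb Hb]]].
  split; apply/graphicalP; split; rewrite -?renewalD // => k kn.
    by apply: H; lia.
  by rewrite -AE; apply: H; rewrite ltn_add2l.
split=> [|k kn]; first by rewrite renewalD.
have [ka|ak] := ltnP k a; first exact: Ha.
by rewrite -(subnKC ak) AE; apply: Hb; lia.
Qed.

Section Periodic.

Variables (n : nat) (g : nat -> int).
Hypotheses (n_gt0 : (0 < n)%N) (gn : forall j, g (n + j)%N = g j).

Lemma psum_period k : psum g n = 0 -> psum g (n + k) = psum g k.
Proof. by move=> Pn; rewrite psumD Pn add0r; apply: (@eq_psum _ _ k) => // j _; apply: gn. Qed.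

Lemma area_period k : renewal g n -> area g (n + k) = area g k.
Proof.
case/andP=> /eqP Pn /eqP An; rewrite areaD Pn An mul0rn !add0r.
by apply: (@eq_area _ _ k) => // j _; apply: gn.
Qed.

Lemma graphical_area_ge0 k : graphical n g -> 0 <= area g k.
Proof.
case/graphicalP=> rn H; elim/ltn_ind: k => k IH.
have [kn|nk] := ltnP k n; first exact: H.
by rewrite -(subnKC nk) area_period //; apply: IH; lia.
Qed.

Lemma renewal_period k : renewal g n -> renewal g (n + k) = renewal g k.
Proof.
by move=> rn; have /andP[/eqP Pn _] := rn; rewrite /renewal psum_period // area_period.
Qed.

(** Over a full period the shifted walk has area [- psum g k *+ n], so its being graphical forces
    height 0 at [k]. Its area at time [n - k] is then [- area g k], which gives [area g k <= 0]; the
    opposite inequality is periodicity. *)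
Lemma shift_graphical k : graphical n g -> (k <= n)%N ->
  graphical n (shift k g) = renewal g k.
Proof.
move=> Gg kn; have /graphicalP[rn H] := Gg; have /andP[/eqP Pn _] := rn.
have AE j : area (shift k g) j = area g (k + j) - area g k - psum g k *+ j.
  by rewrite areaD; ring.
apply/idP/idP => [/graphicalP[/andP[_ An] Hk]|rk].
  have Pk : psum g k = 0.
    move: An; rewrite AE addnC area_period // subrr sub0r oppr_eq0 mulrn_eq0.
    by case/orP => [/eqP|/eqP//]; lia.
  rewrite /renewal Pk eqxx /= eq_le graphical_area_ge0 // andbT.
  have [->|k0] := posnP k; first by rewrite area0.
  have := Hk (n - k)%N; rewrite AE subnKC // Pk mul0rn subr0.
  by have /andP[_ /eqP->] := rn; rewrite sub0r oppr_ge0; apply; lia.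
have /andP[/eqP Pk /eqP Ak] := rk.
apply/graphicalP; split=> [|j jn].
  by rewrite -renewalD // addnC renewal_period.
by rewrite AE Pk Ak mul0rn !subr0 graphical_area_ge0.
Qed.

(** Computing the area at time [n + k] by splitting at [n] and by splitting at [k] yields
    [area g n = psum g k *+ n]. *)
Lemma graphical_rotation_dvdz k : graphical n (shift k g) ->
  psum g n = 0 -> (n %| area g n)%Z.
Proof.
case/graphicalP=> /andP[_ /eqP An] _ Pn.
have := areaD g k n; rewrite An addr0 addnC areaD Pn mul0rn addr0.
rewrite (@eq_area _ g k k) => [|j _|//]; last exact: gn.
rewrite addrC => /addrI ->.
by apply/dvdzP; exists (psum g k); rewrite -mulr_natr natz.
Qed.

Hypothesis g_le1 : forall j, `|g j| <= 1.

Lemma exists_graphical_rotation : psum g n = 0 -> (n %| area g n)%Z ->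
  exists2 p, (0 < p <= n)%N & graphical n (shift p g).
Proof.
move=> Pn /dvdzP[s An].
(* The area recentred at its mean is n-periodic.  A minimum of W at which psum is
   equal to s exists because psum has steps at most 1. *)
pose W k := area g k - s *+ k.
have WS k : W k.+1 = W k + (psum g k.+1 - s) by rewrite /W areaS mulrS; ring.
have Wn k : W (n + k)%N = W k.
  rewrite /W areaD Pn An mul0rn addr0 (@eq_area _ g k k) => [|j _|//]; last exact: gn.
  rewrite mulrnDr.
  by rewrite -[s *+ n]mulr_natr natz; ring.
have good k : psum g k = s -> (forall j, W k <= W j) -> graphical n (shift k g).
  move=> Pk Wk; have AE j : area (shift k g) j = W (k + j)%N - W k.
    by rewrite /W areaD Pk mulrnDr; ring.
  apply/graphicalP; split=> [|j _]; last by rewrite AE subr_ge0.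
  rewrite /renewal AE addnC Wn subrr eqxx andbT.
  have := psumD g k n; rewrite addnC psum_period // => /eqP.
  by rewrite -[X in X == _]addr0 => /eqP/addrI <-.
suff [k k0 [Pk Wk]] : exists2 k, (0 < k)%N & psum g k = s /\ forall j, W k <= W j.
  elim/ltn_ind: k k0 Pk Wk => k IH k0 Pk Wk.
  have [kn|nk] := leqP k n; first by exists k; rewrite ?k0 //; apply: good.
  have E := subnKC (ltnW nk).
  apply: (IH (k - n)%N); rewrite ?subn_gt0 //; first by lia.
    by rewrite -psum_period // E.
  by move=> j; rewrite -Wn E.
pose m := [arg min_(i < Ordinal n_gt0) W i.+1]%O.
have Wm j : W m.+1 <= W j.
  have Wm1 (i : 'I_n) : W m.+1 <= W i.+1.
    by rewrite /m; case: Order.TotalTheory.arg_minP => // i0 _; apply.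
  elim/ltn_ind: j => j IH; have [->|j0] := posnP j.
    have nn : (n.-1 < n)%N by lia.
    by have := Wm1 (Ordinal nn); rewrite /= prednK // -(Wn 0%N) addn0.
  have [jn|nj] := leqP j n.
    have jn' : (j.-1 < n)%N by lia.
    by rewrite -(prednK j0); apply: (Wm1 (Ordinal jn')).
  by rewrite -(subnKC (ltnW nj)) Wn; apply: IH; lia.
(* Minimality of [W] at [m.+1] against its two neighbours gives [psum g m.+1 <= s <= psum g m.+2]. A
   step of at most 1 makes one of these an equality, and in the second case [W] takes the same value
   at [m.+2]. *)
have W1 := Wm m; have W2 := Wm m.+2; have WE1 := WS m; have WE2 := WS m.+1.
have [Pm|Pm] := eqVneq (psum g m.+1) s; first by exists m.+1.
exists m.+2 => //; have := g_le1 m.+1; have := psumS g m.+1 => PS L.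
have E : psum g m.+2 = s by lia.
by split=> // j; apply: le_trans (Wm j); rewrite !WS E subrr addr0.
Qed.

End Periodic.

(** * Decomposition at renewals *)

Lemma nth_rot (T : Type) (x0 : T) (s : seq T) (q i : nat) :
  (q <= size s)%N -> (i < size s)%N ->
  nth x0 (rot q s) i = nth x0 s ((q + i) %% size s).
Proof.
move=> qs si; rewrite /rot nth_cat size_drop.
case: ltnP => [lt|ge]; first by rewrite nth_drop modn_small //; lia.
rewrite nth_take; last by lia.
congr nth; have -> : (q + i = size s + (i - (size s - q)))%N by lia.
by rewrite modnDl modn_small //; lia.
Qed.

(** The bound [p < m] is left to the index of the sums in which this occurs. As at most one index is
    last, such a sum of indicators is 0 or 1. *)
Definition is_last (b : pred nat) (m p : nat) : bool :=
  b p && all (fun k => (p < k)%N ==> ~~ b k) (iota 0 m).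

Lemma sum_is_last (b : pred nat) (m : nat) :
  (\sum_(p < m) is_last b m p = has b (iota 0 m))%N.
Proof.
elim: m => [|m IH]; first by rewrite big_ord0.
have iS : iota 0 m.+1 = iota 0 m ++ [:: m] by rewrite -addn1 iotaD.
rewrite iS has_cat big_ord_recr /= {2}/is_last iS all_cat /= ltnn /= orbF !andbT.
have -> : all (fun k => (m < k)%N ==> ~~ b k) (iota 0 m).
  by apply/allP => k; rewrite mem_iota => km; rewrite ltnNge ltnW.
rewrite andbT; have [bm|bm] := boolP (b m).
  rewrite orbT big1 // => p _; rewrite /is_last iS all_cat /= ltn_ord bm.
  by rewrite !andbF.
rewrite orbF addn0 -IH; apply: eq_bigr => p _.
by rewrite /is_last iS all_cat /= (negPf bm) implybT !andbT.
Qed.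

Lemma sum_triangle (F : nat -> nat -> nat) (n : nat) :
  (\sum_(p < n) \sum_(a < p.+1) F a p =
   \sum_(a < n) \sum_(q < n - a) F a (a + q))%N.
Proof.
elim: n => [|n IH]; first by rewrite !big_ord0.
rewrite big_ord_recr /= IH [RHS]big_ord_recr /= subSnn big_ord1 addn0.
rewrite [X in (_ + X)%N]big_ord_recr /= addnA -big_split /=; congr addn.
apply: eq_bigr => a _; rewrite subSn ?(ltnW (ltn_ord a)) //.
by rewrite big_ord_recr /= subnKC // ltnW.
Qed.

Section LazyWords.

Variables (T : finType) (f : T -> int).

(** The word is read cyclically, so that rotating it amounts to shifting its steps. *)
Definition steps (w : seq T) (j : nat) : int := nth 0 (map f w) (j %% size w).

Lemma steps_period (w : seq T) j : steps w (size w + j) = steps w j.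
Proof. by rewrite /steps modnDl. Qed.

Lemma steps_rot (w : seq T) q j : (0 < size w)%N -> (q <= size w)%N ->
  steps (rot q w) j = shift q (steps w) j.
Proof.
move=> w0 qw; rewrite /shift /steps map_rot size_rot nth_rot ?size_map //.
  by rewrite modnDmr.
by rewrite ltn_mod.
Qed.

Lemma steps_catl (u v : seq T) j : (j < size u)%N -> steps (u ++ v) j = steps u j.
Proof.
move=> ju; rewrite /steps map_cat nth_cat size_map size_cat !modn_small ?ju //.
by apply: ltn_addr.
Qed.

Lemma steps_catr (u v : seq T) j : (j < size v)%N ->
  shift (size u) (steps (u ++ v)) j = steps v j.
Proof.
move=> jv; rewrite /shift /steps map_cat nth_cat size_map size_cat.
by rewrite !modn_small ?ltn_add2l // ltnNge leq_addr addKn.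
Qed.

Definition num_graphical n : nat :=
  #|[set w : n.-tuple T | graphical n (steps w)]|.

Definition is_bridge_dvd n (w : seq T) : bool :=
  (psum (steps w) n == 0) && (n %| area (steps w) n)%Z.

Definition num_bridges_dvd n : nat := #|[set w : n.-tuple T | is_bridge_dvd n w]|.

(** Here [q] is the marked time: no renewal occurs at the times 1 to [q], time 0 being always
    one. *)
Definition fresh_graphical n q (w : seq T) : bool :=
  graphical n (steps w) &&
  all (fun k => (0 < k)%N ==> ~~ renewal (steps w) k) (iota 0 q.+1).

Lemma card_split_renewal a b n q : n = (a + b)%N -> (q < b)%N ->
  #|[set w : n.-tuple T | graphical n (steps w) &&
                          is_last (renewal (steps w)) (a + q).+1 a]| =
  (num_graphical a * #|[set v : b.-tuple T | fresh_graphical b q v]|)%N.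
Proof.
move=> {n}-> qb; rewrite /num_graphical -cardsX.
pose h (x : a.-tuple T * b.-tuple T) := [tuple of x.1 ++ x.2].
have hinj : injective h.
  move=> [u v] [u' v'] /(congr1 val) /= /eqP.
  by rewrite eqseq_cat ?size_tuple // => /andP[/eqP/val_inj-> /eqP/val_inj->].
rewrite -(card_imset _ hinj); apply: eq_card => w; rewrite inE.
have [x ->] : exists x, w = h x.
  have sz1 : size (take a w) == a by rewrite size_takel // size_tuple leq_addr.
  have sz2 : size (drop a w) == b by rewrite size_drop size_tuple addKn.
  exists (Tuple sz1, Tuple sz2); apply: val_inj => /=.
  by rewrite cat_take_drop.
rewrite (mem_imset _ _ hinj) !inE {w}; case: x => u v /=.
rewrite /fresh_graphical /is_last.
set g := steps _; have su : size u = a by rewrite size_tuple.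
have sv : size v = b by rewrite size_tuple.
have gu j : (j < a)%N -> g j = steps u j by move=> ja; apply: steps_catl; rewrite su.
have gv j : (j < b)%N -> shift a g j = steps v j.
  by move=> jb; have := @steps_catr u v j; rewrite su sv; apply.
have [ra|ra] := boolP (renewal g a); last first.
  by rewrite andbF; apply/esym/negbTE; apply: contra ra => /andP[/graphicalP[+ _] _];
     rewrite (eq_renewal gu).
rewrite graphicalD // (eq_graphical gu) (eq_graphical gv) -andbA /=.
congr (_ && (_ && _)).
apply/allP/allP => H k; rewrite mem_iota /= => kq; apply/implyP => k0.
  have ak : (a < a + k)%N by lia.
  have := H (a + k)%N; rewrite mem_iota ak /=.
  rewrite renewalD // (eq_renewal gv); last by lia.
  by apply; lia.
rewrite -(subnKC (ltnW k0)) renewalD // (eq_renewal gv); last by lia.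
have := H (k - a)%N; rewrite mem_iota subn_gt0 k0 /=; apply; lia.
Qed.

Hypothesis f_le1 : forall t, `|f t| <= 1.

Lemma steps_le1 w j : `|steps w j| <= 1.
Proof.
rewrite /steps; have [lt|ge] := ltnP (j %% size w) (size w).
  have [t _] : exists t, t \in w.
    by case: w lt => // t w _; exists t; rewrite inE eqxx.
  by rewrite (nth_map t).
by rewrite nth_default ?size_map ?normr0.
Qed.

(* The rotations of a bridge which are graphical start at the minima of its
   recentred area; the mark selects the last of them. *)
Lemma sum_fresh_graphical b : (0 < b)%N ->
  (\sum_(q < b) #|[set v : b.-tuple T | fresh_graphical b q v]| =
   num_bridges_dvd b)%N.
Proof.
(* The word [x] is the bridge read from its mark, so the marked bridge itself starts at time [b - q]
   of [x]. *)
move=> b0; transitivity (\sum_(q < b) \sum_(x : b.-tuple T)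
    fresh_graphical b q (rot (b - q) x))%N.
  apply: eq_bigr => q _; rewrite -sum1_card big_mkcond /=.
  have hinj : injective (fun x : b.-tuple T => [tuple of rot (b - q) x]).
    by move=> x y /(congr1 val) /= /rot_inj /val_inj.
  rewrite (reindex_inj hinj); apply: eq_bigr => x _; rewrite inE /=.
  by case: ifP.
rewrite exchange_big /= /num_bridges_dvd -sum1_card [RHS]big_mkcond /=.
apply: eq_bigr => x _; rewrite inE.
have sx : size x = b by rewrite size_tuple.
set g := steps x; have gb j : g (b + j)%N = g j by rewrite -{1}sx; exact: steps_period.
pose beta i := graphical b (shift i.+1 g).
transitivity (\sum_(i < b) is_last beta b i)%N.
  (* With [q = b - i.+1] the graphical bridge starts at time [i.+1] of [x]. By [shift_graphical] its
     renewals up to [q] are exactly the later graphical starts of [x], so freshness says that [i] is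
     the last of them. *)
  rewrite (reindex_inj rev_ord_inj); apply: eq_bigr => i _ /=; congr nat_of_bool.
  have -> : (b - (b - i.+1) = i.+1)%N by have := ltn_ord i; lia.
  have hs j : steps (rot i.+1 x) j = shift i.+1 g j by rewrite steps_rot ?sx.
  rewrite /fresh_graphical (@eq_graphical _ _ b (fun j _ => hs j)) -/(beta i).
  rewrite /is_last; have [bi|//] := boolP (beta i); rewrite /=.
  have hb j : shift i.+1 g (b + j)%N = shift i.+1 g j.
    by rewrite /shift addnCA gb.
  have key k : (i.+1 + k <= b)%N ->
      renewal (steps (rot i.+1 x)) k = beta (i + k)%N.
    move=> kb; rewrite (@eq_renewal _ _ k k (fun j _ => hs j)) //.
    rewrite -(@shift_graphical _ _ b0 hb k) //; last by lia.
    by apply: eq_graphical => j _; rewrite /shift; congr g; lia.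
  apply/allP/allP => H k; rewrite mem_iota /= => kq; apply/implyP => k0.
    have ik : (i + (k - i) = k)%N by lia.
    rewrite -ik -key; last by lia.
    by have := H (k - i)%N; rewrite mem_iota subn_gt0 k0 /=; apply; lia.
  rewrite key; last by lia.
  have ik : (i < i + k)%N by lia.
  have := H (i + k)%N; rewrite mem_iota ik /=.
  by apply; lia.
rewrite sum_is_last /is_bridge_dvd -/g.
have [/eqP Pb|Pb] /= := boolP (psum g b == 0).
  have [Ab|Ab] /= := boolP (b %| area g b)%Z.
    have [|p /andP[p0 pb] Gp] := exists_graphical_rotation b0 gb _ Pb Ab.
      by move=> j; exact: steps_le1.
    have -> // : has beta (iota 0 b).
    apply/hasP; exists p.-1; first by rewrite mem_iota; lia.
    by rewrite /beta prednK.
  suff -> : has beta (iota 0 b) = false by [].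
  apply: contraNF Ab => /hasP[i _ Gi].
  exact: (graphical_rotation_dvdz gb Gi).
suff -> : has beta (iota 0 b) = false by [].
apply: contraNF Pb => /hasP[i _ /graphicalP[]].
rewrite /renewal => /andP[/eqP H _] _.
have := psumD g i.+1 b; rewrite H addr0 addnC psumD.
rewrite (@eq_psum _ g i.+1 i.+1) => [/eqP|j _|//]; last exact: gb.
by rewrite -subr_eq0 addrK.
Qed.

Lemma num_graphical_rec n :
  (n * num_graphical n =
   \sum_(a < n) num_graphical a * num_bridges_dvd (n - a))%N.
Proof.
(* Each mark [p] has exactly one last renewal [a <= p], since time 0 is a renewal. Writing
   [p = a + q] then separates the two pieces. *)
transitivity (\sum_(w in [set w : n.-tuple T | graphical n (steps w)])
   \sum_(p < n) \sum_(a < p.+1) is_last (renewal (steps w)) p.+1 a)%N.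
  rewrite mulnC -sum_nat_const; apply: eq_bigr => w _.
  rewrite -[LHS]card_ord -sum1_card; apply: eq_bigr => p _.
  by rewrite sum_is_last /= renewal0.
under eq_bigr => w _ do rewrite (sum_triangle (fun a p => is_last _ p.+1 a)).
rewrite exchange_big /=; apply: eq_bigr => a _.
rewrite -sum_fresh_graphical ?subn_gt0 // big_distrr exchange_big /=.
apply: eq_bigr => q _.
rewrite -(@card_split_renewal a (n - a) n q) ?subnKC // 1?ltnW //.
rewrite -sum1_card big_mkcond [RHS]big_mkcond /=; apply: eq_bigr => w _.
by rewrite !inE; case: (graphical n _) => //=; case: is_last.
Qed.

End LazyWords.

(** * Bridges as lazy walks *)

(* Half the sum of the two +1 or -1 steps encoded by the booleans. *)
Definition half_step (p : bool * bool) : int := (p.1 + p.2)%N%:Z - 1.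

Lemma half_step_le1 p : `|half_step p| <= 1.
Proof. by case: p => [[] []]. Qed.

Section Pairing.

Variable n : nat.

Definition bit (w : seq (bool * bool)) (j : nat) : bool :=
  let p := nth (false, false) w j./2 in if odd j then p.2 else p.1.

Definition unpair (w : n.-tuple (bool * bool)) : {ffun 'I_(2 * n) -> bool} :=
  [ffun j : 'I_(2 * n) => bit w j].

Lemma unpair_bij : bijective unpair.
Proof.
apply: inj_card_bij; last first.
  by rewrite card_ffun card_tuple card_prod card_bool card_ord expnM.
move=> u v uv; apply: val_inj; apply: (@eq_from_nth _ (false, false)).
  by rewrite !size_tuple.
move=> i; rewrite size_tuple => i_n.
have b0 : (i.*2 < 2 * n)%N by lia.
have b1 : (i.*2.+1 < 2 * n)%N by lia.
have := congr1 (fun s : {ffun _} => s (Ordinal b1)) uv.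
have := congr1 (fun s : {ffun _} => s (Ordinal b0)) uv.
rewrite !ffunE /bit /= odd_double /= doubleK uphalf_double.
by case: nth => a b; case: nth => c d /= -> ->.
Qed.

Lemma walk_unpair (w : n.-tuple (bool * bool)) k : (k <= n)%N ->
  walk (unpair w) (2 * k) = 2 * psum (steps half_step w) k.
Proof.
move=> kn; rewrite /walk.
pose F (j : nat) : int := if bit w j then 1 else -1.
rewrite (eq_bigr (fun j : 'I_(2 * n) => F j)) => [|j _]; last by rewrite ffunE.
rewrite -(big_ord_widen _ F); last by lia.
elim: k kn => [|k IH] kn; first by rewrite muln0 psum0 big_ord0 mulr0.
rewrite mulnS addnC !addnS addn0 !big_ord_recr /= IH ?(ltnW kn) // psumS mulrDr.
rewrite -addrA; congr (_ + _); rewrite /F /bit mul2n /= odd_double /=.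
rewrite doubleK uphalf_double /steps size_tuple modn_small //.
rewrite (nth_map (false, false)) ?size_tuple // /half_step.
by case: nth => [[] []].
Qed.

Lemma diamond_area_unpair (w : n.-tuple (bool * bool)) k : (k <= n)%N ->
  diamond_area (walk (unpair w)) k = (area (steps half_step w) k)%:~R.
Proof.
move=> kn; rewrite /diamond_area big_add1 /= big_mkord.
rewrite (eq_bigr (fun i : 'I_k => 2 * psum (steps half_step w) i.+1)).
  by rewrite -mulr_sumr intrM mulrAC divff // mul1r.
by move=> i _; rewrite walk_unpair // (leq_trans _ kn).
Qed.

Lemma num_graphical_bridgesE :
  num_graphical_bridges n = num_graphical half_step n.
Proof.
rewrite /num_graphical_bridges -(on_card_preimset (onW_bij _ unpair_bij)).
apply: eq_card => w; rewrite !inE /is_bridge /is_graphical /graphical /renewal.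
rewrite walk_unpair // diamond_area_unpair // mulf_eq0 /= intr_eq0 -andbA.
congr (_ && (_ && _)); apply: eq_forallb => k.
rewrite diamond_area_unpair; last by rewrite ltnW.
(* At time 0 one side is vacuous and the other holds because the area is 0. *)
by rewrite ler0z; case: (posnP k) => // ->; rewrite area0.
Qed.

End Pairing.

(** * Bridges whose area is divisible by the length *)

Lemma prod_ord_period (R : comNzRingType) (G : nat -> R) (m d : nat) :
  (forall j, G (m + j)%N = G j) ->
  \prod_(j < d * m) G j = (\prod_(j < m) G j) ^+ d.
Proof.
move=> Gm; elim: d => [|d IH]; first by rewrite mul0n big_ord0 expr0.
rewrite mulSn big_split_ord exprS /= -IH; congr (_ * _).
by apply: eq_bigr => j _; rewrite Gm.
Qed.

Section RootsOfUnity.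

Variable F : fieldType.

(** Substituting -X in the factorization of X^m - 1 gives this, up to the sign of m factors. *)
Lemma prod_X_add_root m (u : F) : m.-primitive_root u ->
  \prod_(j < m) ('X + (u ^+ j)%:P) = 'X^m - ((-1) ^+ m)%:P.
Proof.
move=> um; have := congr1 (comp_poly (- 'X)) (factor_Xn_sub_1 um).
rewrite big_mkord rmorph_prod /= rmorphB /= rmorphXn /= comp_polyX rmorph1.
rewrite (eq_bigr (fun j : 'I_m => - ('X + (u ^+ j)%:P))) => [|j _]; last first.
  by rewrite rmorphB /= comp_polyX comp_polyC opprD.
rewrite prodrN card_ord [(- 'X) ^+ m]exprNn => /(congr1 (fun p => (-1) ^+ m * p)).
rewrite /= mulrBr !signrMK mulr1 => ->.
by rewrite rmorphXn rmorphN rmorph1.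
Qed.

Lemma prod_root m (u : F) : m.-primitive_root u ->
  \prod_(j < m) u ^+ j = - (-1) ^+ m.
Proof.
move=> um; have := congr1 (horner^~ 0) (prod_X_add_root um).
rewrite horner_prod !hornerE expr0n eqn0Ngt (prim_order_gt0 um) sub0r => <-.
by apply: eq_bigr => j _; rewrite !hornerE.
Qed.

(** Only the middle term of the binomial expansion has degree [d * m]. *)
Lemma coef_exp_Xn_addC (c : F) m d : (0 < m)%N ->
  (('X^m + c%:P) ^+ (2 * d))`_(d * m) = c ^+ d *+ 'C(2 * d, d).
Proof.
move=> m0; rewrite exprDn coef_sum.
have d2 : (d < (2 * d).+1)%N by lia.
rewrite (bigD1 (Ordinal d2)) //= big1 ?addr0 => [|i ne].
  have -> : (2 * d - d = d)%N by lia.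
  by rewrite coefMn -exprM -rmorphXn coefMC coefXn mulnC eqxx mul1r.
rewrite coefMn -exprM -rmorphXn coefMC coefXn.
suff /negPf-> : (d * m)%N != (m * (2 * d - i))%N by rewrite mul0r mul0rn.
apply: contraNneq ne; rewrite mulnC => /eqP; rewrite eqn_pmul2l // => /eqP E.
by apply/eqP/val_inj => /=; have := ltn_ord i; lia.
Qed.

(** Since [u = z ^+ n.-1] is the inverse of z, each factor equals z^j (X + u^j)^2. With d = n / m
    full periods, the product is (-(-1)^m)^d (X^m - (-1)^m)^(2d), and in the coefficient of degree d
    m the signs cancel. *)
Lemma coef_prod_root n (z : F) m : (0 < n)%N -> (m %| n)%N ->
  m.-primitive_root z ->
  (\prod_(j < n) ((z ^+ j) ^+ n.-1 *: (1 + (z ^+ j) *: 'X) ^+ 2))`_n =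
  ('C(2 * (n %/ m), n %/ m))%:R.
Proof.
move=> n0 mn zm; have m0 := prim_order_gt0 zm.
have zn : z ^+ n = 1 by apply/eqP; rewrite -(prim_order_dvd zm).
pose u := z ^+ n.-1.
have um : m.-primitive_root u.
  rewrite prim_root_exp_coprime //; apply: (coprime_dvdr mn).
  by rewrite -{2}(prednK n0) coprimenS.
have yu j : z ^+ j * u ^+ j = 1 by rewrite -exprMn -exprS prednK // zn expr1n.
rewrite (eq_bigr (fun j : 'I_n => (z ^+ j)%:P * ('X + (u ^+ j)%:P) ^+ 2)); last first.
  move=> j _; rewrite exprAC -/u -!mul_polyC.
  have E : (z ^+ j)%:P * (u ^+ j)%:P = 1 :> {poly F} by rewrite -polyCM yu.
  move: E; set a := _%:P; set b := _%:P => E.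
  transitivity ((b + a * b * 'X) * (1 + a * 'X)); first by rewrite expr2; ring.
  rewrite E mul1r -[X in _ * (X + _)]E; ring.
pose G (y : F) (v : F) := y%:P * ('X + v%:P) ^+ 2.
rewrite big_split /= prodrXl; set d := (n %/ m)%N; have nE : n = (d * m)%N by rewrite divnK.
have zp j : z ^+ (m + j) = z ^+ j by rewrite exprD (prim_expr_order zm) mul1r.
have up j : u ^+ (m + j) = u ^+ j by rewrite exprD (prim_expr_order um) mul1r.
rewrite [X in _`_X]nE.
have -> : \prod_(i < n) (z ^+ i)%:P = (\prod_(i < m) (z ^+ i)%:P) ^+ d.
  by rewrite nE (@prod_ord_period _ (fun j => (z ^+ j)%:P)) // => j; rewrite zp.
have -> : \prod_(i < n) ('X + (u ^+ i)%:P) = (\prod_(i < m) ('X + (u ^+ i)%:P)) ^+ d.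
  by rewrite nE (@prod_ord_period _ (fun j => 'X + (u ^+ j)%:P)) // => j; rewrite up.
rewrite prod_X_add_root // -rmorph_prod prod_root // -exprM [(d * 2)%N]mulnC.
rewrite -rmorphXn coefCM -polyCN coef_exp_Xn_addC // mulrnAr -exprMn.
by rewrite mulrNN -expr2 sqrr_sign expr1n.
Qed.

End RootsOfUnity.

(* When psum g k = 0, the area is minus the first moment of the steps. *)
Lemma area_psum g k : area g k + \sum_(j < k) g j *+ j = psum g k *+ k.
Proof.
elim: k => [|k IH]; first by rewrite area0 big_ord0 addr0 mulr0n.
by rewrite areaS big_ord_recr /= addrACA IH psumS [in RHS]mulrSr mulrnDl; ring.
Qed.

Lemma sum_root_unity (F : fieldType) n (z : F) e : n.-primitive_root z ->
  \sum_(k < n) (z ^+ k) ^+ e = (n * (n %| e))%N%:R.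
Proof.
move=> zn; have E (k : 'I_n) : true -> (z ^+ k) ^+ e = (z ^+ e) ^+ k by rewrite exprAC.
rewrite (eq_bigr _ E) (prim_order_dvd zn) /=; have [->|ne] := eqVneq (z ^+ e) 1.
  rewrite (eq_bigr (fun=> 1)) => [|i _]; last by rewrite expr1n.
  by rewrite sumr_const card_ord muln1.
rewrite muln0; have := subrX1 (z ^+ e) n.
rewrite -exprM mulnC exprM (prim_expr_order zn) expr1n subrr => /esym/eqP.
by rewrite mulf_eq0 subr_eq0 (negPf ne) => /eqP.
Qed.

Definition ups (p : bool * bool) : nat := p.1 + p.2.

(** The indicator of [n %| E w], times n, is the sum over k of z^(k E w). For fixed k, the sum over
    words with n ups is a coefficient of a product with one factor per position. As z^k has order n
    / gcd(k, n), [coef_prod_root] evaluates it. *)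
Lemma num_bridges_dvdE n : (0 < n)%N ->
  (n * num_bridges_dvd half_step n =
   \sum_(k < n) 'C(2 * gcdn k n, gcdn k n))%N.
Proof.
move=> n0; have [z zn] := C_prim_root_exists n0.
apply/eqP; rewrite -(eqr_nat algC); apply/eqP.
pose W (w : n.-tuple (bool * bool)) := (\sum_(j < n) ups (tnth w j))%N.
(* E w is congruent to the first moment of the steps modulo n; the summand n.-1
   stands for -1, so as to keep exponents natural. *)
pose E (w : n.-tuple (bool * bool)) := (\sum_(j < n) j * (ups (tnth w j) + n.-1))%N.
have bE (w : n.-tuple (bool * bool)) :
    is_bridge_dvd half_step n w = (W w == n) && (n %| E w)%N.
  have sE (j : 'I_n) : steps half_step w j = (ups (tnth w j))%:Z - 1.
    rewrite /steps size_tuple modn_small // (nth_map (false, false)) ?size_tuple //.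
    by rewrite /half_step (tnth_nth (false, false)).
  have P : psum (steps half_step w) n = (W w)%:Z - n%:Z.
    rewrite /psum (eq_bigr _ (fun j _ => sE j)) sumrB sumr_const card_ord natz.
    by rewrite /W (big_morph Posz PoszD (erefl 0%:Z)).
  rewrite /is_bridge_dvd P subr_eq0 eqz_nat; case: eqVneq => //= Wn.
  have := area_psum (steps half_step w) n; rewrite P Wn subrr mul0rn.
  move/eqP; rewrite addr_eq0 => /eqP->.
  rewrite dvdzE abszN -[in RHS](absz_nat n) -[in RHS](absz_nat (E w)) -!dvdzE.
  (* Since [ups] is the step plus 1, [ups + n.-1] is the step plus n. *)
  have -> : (E w)%:Z = \sum_(j < n) (steps half_step w j *+ j) +
              n%:Z * \sum_(j < n) (j%:Z).
    rewrite mulr_sumr -big_split /E (big_morph Posz PoszD (erefl 0%:Z)).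
    apply: eq_bigr => j _ /=; rewrite sE PoszM PoszD -subn1 -subzn //; ring.
  by rewrite rpredDr // dvdz_mulr.
have key (k : 'I_n) :
    \sum_(w : n.-tuple (bool * bool)) (W w == n)%:R * (z ^+ k) ^+ E w =
    ('C(2 * gcdn k n, gcdn k n))%:R.
  have mn : (n %/ gcdn k n %| n)%N by rewrite dvdn_div // dvdn_gcdr.
  have := coef_prod_root n0 mn (exp_prim_root zn k).
  have -> : (n %/ (n %/ gcdn k n) = gcdn k n)%N.
    by rewrite divnA ?dvdn_gcdr // mulKn.
  move=> <-; set y := z ^+ k.
  (* This is the weight of the pair [p] at position [j]; summed over the four pairs it gives the
     factor y^(j(n-1)) (1 + y^j X)^2 of [coef_prod_root]. *)
  pose Fm (j : 'I_n) (p : bool * bool) : {poly algC} :=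
    (y ^+ (j * (ups p + n.-1))) *: 'X^(ups p).
  rewrite (eq_bigr (fun j => \sum_p Fm j p)) => [|j _]; last first.
    rewrite -(pair_bigA _ (fun a b => Fm j (a, b))) /=.
    rewrite !big_bool /= /Fm /ups /= expr0 expr1.
    have pw b : y ^+ (j * (b + n.-1)) = (y ^+ j) ^+ b * y ^+ j ^+ n.-1.
      by rewrite mulnDr exprD !exprM.
    rewrite !pw add0n addn0 -[(1 + 1)%N]/2%N -!mul_polyC !polyCM !rmorphXn /=; ring.
  rewrite bigA_distr_bigA /= coef_sum.
  rewrite (reindex (fun f : {ffun 'I_n -> bool * bool} => [tuple f i | i < n])) /=.
    apply: eq_bigr => f _; rewrite /Fm.
    have -> : \prod_(i < n) (y ^+ (i * (ups (f i) + n.-1)) *: 'X^(ups (f i))) =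
        (y ^+ E [tuple f i | i < n]) *: 'X^(W [tuple f i | i < n]) :> {poly algC}.
      rewrite /E /W; under [X in y ^+ X]eq_bigr do rewrite tnth_mktuple.
      under [X in 'X^X]eq_bigr do rewrite tnth_mktuple.
      by rewrite scaler_prod !prodrXr.
    by rewrite coefZ coefXn eq_sym mulrC.
  exists (fun w : n.-tuple _ => [ffun i => tnth w i]) => [f _ | w _].
    by apply/ffunP => i; rewrite ffunE tnth_mktuple.
  by apply: eq_from_tnth => i; rewrite tnth_mktuple ffunE.
rewrite natr_sum -(eq_bigr _ (fun k _ => key k)) exchange_big /=.
rewrite /num_bridges_dvd -sum1_card big_distrr natr_sum big_mkcond /=.
apply: eq_bigr => w _; rewrite -mulr_sumr sum_root_unity // inE bE.
by case: eqP => _; case: (_ %| _)%N; rewrite ?muln1 ?muln0 ?mul0r ?mul1r.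
Qed.

(** * Necklaces *)

Lemma sum_ord_period (G : nat -> nat) (m d : nat) :
  (forall j, G (m + j) = G j)%N ->
  (\sum_(j < d * m) G j = d * \sum_(j < m) G j)%N.
Proof.
move=> Gm; elim: d => [|d IH]; first by rewrite mul0n big_ord0.
rewrite mulSn big_split_ord mulSn /= -IH; congr (_ + _)%N.
by apply: eq_bigr => j _; rewrite Gm.
Qed.

Lemma sum_ord_double (G : nat -> nat) n :
  (\sum_(k < 2 * n) G k = \sum_(k < n) (G k.*2 + G k.*2.+1))%N.
Proof.
elim: n => [|n IH]; first by rewrite !big_ord0.
by rewrite mulnS addnC addn2 !big_ord_recr /= IH mul2n addnA.
Qed.

Section Necklaces.

Variable N : nat.
Local Notation word := {ffun 'I_N.+1 -> bool}.

(** The necklace unrolled periodically. The length is written [N.+1] so that positions form a cyclic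
    group, which acts by rotation. *)
Definition per (w : word) (i : nat) : bool := w (inZp i).

Definition rotate (w : word) (k : 'I_N.+1) : word := [ffun i => w (i + k)].

Definition rotations (w : word) : {set word} := [set rotate w k | k : 'I_N.+1].

Definition balanced (n : nat) : {set word} := [set w : word | (\sum_i w i == n)%N].

Lemma per_period w i : per w (N.+1 + i) = per w i.
Proof. by congr (w _); apply: val_inj; rewrite /= modnDl. Qed.

Lemma per_rotate w k i : per (rotate w k) i = per w (i + k).
Proof. by rewrite /per ffunE; congr (w _); apply: val_inj; rewrite /= modnDml. Qed.

Lemma per_ord w (i : 'I_N.+1) : per w i = w i.
Proof. by rewrite /per valZpK. Qed.

Lemma eq_per w w' : per w =1 per w' -> w = w'.
Proof. by move=> E; apply/ffunP => i; rewrite -!per_ord E. Qed.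

Lemma rotateP (w w' : word) :
  reflect (exists k : nat, forall i, per w' i = per w (i + k)) (w' \in rotations w).
Proof.
apply: (iffP imsetP) => [[k _ ->]|[k H]].
  by exists k => i; rewrite per_rotate.
exists (inZp k) => //; apply: eq_per => i; rewrite per_rotate H.
by congr (w _); apply: val_inj; rewrite /= modnDmr.
Qed.

Lemma rotate_is_action : is_action [set: 'I_N.+1] rotate.
Proof.
split=> [k w w' E | w k l _ _]; last first.
  by apply/ffunP => i; rewrite !ffunE; congr (w _); rewrite -addrA [l + k]addrC.
apply/ffunP => i; have := congr1 (fun v : word => v (i - k)) E.
by rewrite !ffunE subrK.
Qed.

Canonical rotate_action := Action rotate_is_action.

Lemma rotationsE w : rotations w = orbit rotate_action [set: 'I_N.+1] w.
Proof.
by apply/setP => v; apply/imsetP/imsetP => -[k _ ->]; exists k; rewrite ?inE.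
Qed.

Lemma sum_rotate w k : (\sum_i rotate w k i = \sum_i w i)%N.
Proof.
rewrite [RHS](reindex_inj (addIr k)) /=; apply: eq_bigr => i _.
by rewrite ffunE.
Qed.

Lemma rotations_eq w w' : (rotations w == rotations w') = (w' \in rotations w).
Proof. by rewrite !rotationsE eq_sym orbit_eq_mem. Qed.

Lemma card_necklaces n :
  (#|[set rotations w | w in balanced n]| * N.+1 =
   \sum_(k < N.+1) #|[set w in balanced n | rotate w k == w]|)%N.
Proof.
have acts : [acts [set: 'I_N.+1], on balanced n | rotate_action].
  apply/subsetP => k _; rewrite !inE; apply/subsetP => w; rewrite !inE /=.
  by rewrite sum_rotate.
have := Frobenius_Cauchy acts; rewrite cardsT card_ord => E.
rewrite (eq_imset _ rotationsE) -E big_mkcond /=.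
apply: eq_bigr => k _; rewrite in_setT; apply: eq_card => w.
by rewrite !inE sub1set !inE.
Qed.

Lemma per_addM w m i q : (forall j, per w (j + m) = per w j) ->
  per w (i + q * m) = per w i.
Proof.
by move=> H; elim: q => [|q IH]; rewrite ?addn0 // mulSn addnCA addnC H.
Qed.

Lemma per_mod w m i : (forall j, per w (j + m) = per w j) ->
  per w (i %% m) = per w i.
Proof. by move=> H; rewrite [in RHS](divn_eq i m) addnC per_addM. Qed.

(** Both [k] and [N.+1] are periods of a fixed word, hence so is their gcd, by Bezout. *)
Lemma rotate_fixedP (w : word) (k : nat) :
  reflect (forall i, per w (i + gcdn k N.+1) = per w i) (rotate w (inZp k) == w).
Proof.
have E i : per (rotate w (inZp k)) i = per w (i + k).
  by rewrite per_rotate; congr (w _); apply: val_inj; rewrite /= modnDmr.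
apply: (iffP eqP) => H; last first.
  apply: eq_per => i; rewrite E; have /dvdnP[q ->] := dvdn_gcdl k N.+1.
  exact: per_addM.
have perN j : per w (j + N.+1) = per w j by rewrite addnC per_period.
have perk j : per w (j + k) = per w j by rewrite -E H.
have [->|k0] := posnP k; first by move=> i; rewrite gcd0n.
move=> i; case: (egcdnP N.+1 k0) => km kn Ek _.
by rewrite -(per_addM _ kn perN) -addnA [(gcdn _ _ + _)%N]addnC -Ek per_addM.
Qed.

(** Such a word repeats a block of length [e.+1], and it is balanced exactly when the block is half
    ups. *)
Lemma card_periodic_balanced n (e : nat) : N.+1 = (2 * n)%N -> (e.+1 %| N.+1)%N ->
  #|[set w in balanced n | [forall i : 'I_N.+1, per w (i + e.+1) == w i]]| =
  #|[set u : {ffun 'I_e.+1 -> bool} | (2 * \sum_i u i == e.+1)%N]|.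
Proof.
move=> Nn eN; pose F (u : {ffun 'I_e.+1 -> bool}) : word := [ffun i : 'I_N.+1 => u (inZp i)].
have perF u i : per (F u) i = u (inZp i).
  by rewrite /per ffunE; congr (u _); apply: val_inj; rewrite /= modn_dvdm.
have Finj : injective F.
  move=> u v uv; apply/ffunP => i; have := perF v i; rewrite -uv perF.
  by rewrite !valZpK.
rewrite -[RHS](card_imset _ Finj); apply: eq_card => w.
have FE u : (F u \in balanced n) = (2 * \sum_i u i == e.+1)%N.
  rewrite inE; have [c cE] := dvdnP eN.
  have -> : (\sum_i F u i = \sum_(i < c * e.+1) u (inZp i))%N.
    by rewrite -cE; apply: eq_bigr => i _; rewrite ffunE.
  rewrite (@sum_ord_period (fun i => u (inZp i))) => [|j]; last first.
    by congr (nat_of_bool (u _)); apply: val_inj; rewrite /= modnDl.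
  rewrite (eq_bigr (fun i => u i : nat)) => [|i _]; last by rewrite valZpK.
  have c0 : (0 < c)%N by case: c cE.
  rewrite -(eqn_pmul2l (isT : 0 < 2)%N) -Nn cE mulnCA eqn_pmul2l //.
rewrite inE; apply/andP/imsetP => [[wb /forallP H]|[u + ->]]; last first.
  rewrite inE -FE => ->; split=> //; apply/forallP => i; rewrite perF ffunE.
  by apply/eqP; congr (u _); apply: val_inj; rewrite /= modnDr.
have wE : w = F [ffun i : 'I_e.+1 => per w i].
  apply: eq_per => i; rewrite perF ffunE /=; apply/esym/per_mod => j.
  have -> : per w (j + e.+1) = per w ((inZp j : 'I_N.+1) + e.+1).
    by rewrite /per; congr (w _); apply: val_inj; rewrite /= modnDml.
  exact/eqP.
by eexists; last exact: wE; rewrite inE -FE -wE.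
Qed.

Lemma card_half_words (e : nat) :
  #|[set u : {ffun 'I_e -> bool} | (2 * \sum_i u i == e)%N]| =
  if odd e then 0%N else 'C(e, e./2).
Proof.
case: ifPn => oe.
  apply/eqP; rewrite cards_eq0 -subset0; apply/subsetP => u; rewrite !inE.
  by move/eqP => E; move: oe; rewrite -E mul2n odd_double.
pose S (u : {ffun 'I_e -> bool}) := [set i | u i].
have Sbij : bijective S.
  exists (fun A : {set 'I_e} => [ffun i => i \in A]) => [u|A].
    by apply/ffunP => i; rewrite ffunE inE.
  by apply/setP => i; rewrite inE ffunE.
rewrite -[in RHS](card_ord e) -card_draws card_ord.
rewrite -(on_card_preimset (onW_bij _ Sbij)); apply: eq_card => u; rewrite !inE.
have half m : (2 * m == e)%N = (m == e./2)%N.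
  by rewrite -{1}(even_halfK oe) -mul2n eqn_pmul2l.
rewrite half /S cardsE -sum1_card.
by rewrite [in RHS]big_mkcond /=; congr (_ == _); apply: eq_bigr => i _; case: (u i).
Qed.

Lemma card_fixed n k : N.+1 = (2 * n)%N ->
  #|[set w in balanced n | rotate w (inZp k) == w]| =
  if odd (gcdn k N.+1) then 0%N else 'C(gcdn k N.+1, (gcdn k N.+1)./2).
Proof.
move=> Nn; have e0 : (0 < gcdn k N.+1)%N by rewrite gcdn_gt0 orbT.
rewrite -card_half_words -(prednK e0) -(card_periodic_balanced Nn).
  apply: eq_card => w; rewrite !inE prednK //; congr (_ && _).
  apply/rotate_fixedP/forallP => [H i|H i]; first by rewrite H per_ord.
  rewrite -[per w i]/(w (inZp i)) -(eqP (H (inZp i))).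
  by congr (w _); apply: val_inj; rewrite /= modnDml.
by rewrite prednK // dvdn_gcdr.
Qed.

(** A rotation by an odd amount has an odd gcd with 2n, and no block of odd length is half ups. A
    rotation by 2k has gcd 2 gcd(k, n). *)
Lemma num_necklaces n : N.+1 = (2 * n)%N ->
  (#|[set rotations w | w in balanced n]| * (2 * n) =
   \sum_(k < n) 'C(2 * gcdn k n, gcdn k n))%N.
Proof.
move=> Nn; rewrite -Nn card_necklaces.
pose G k := if odd (gcdn k N.+1) then 0%N else 'C(gcdn k N.+1, (gcdn k N.+1)./2).
rewrite (eq_bigr (fun k : 'I_N.+1 => G k)) => [|k _]; last first.
  by rewrite /G -(card_fixed _ Nn) valZpK.
rewrite Nn sum_ord_double; apply: eq_bigr => k _.
rewrite /G Nn -mul2n -muln_gcdr.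
have -> : odd (gcdn (2 * k).+1 (2 * n)).
  have /dvdnP[q E] := dvdn_gcdl (2 * k).+1 (2 * n).
  by have := congr1 odd E; rewrite oddM /= mul2n odd_double => /esym/andP[].
by rewrite mul2n odd_double doubleK addn0 -mul2n.
Qed.

End Necklaces.

Local Close Scope ring_scope.

(** * Rooted trees and contour walks *)

Lemma crossing (T : Type) (S : pred T) (x : nat -> T) i j :
  i <= j -> S (x i) -> ~~ S (x j) ->
  exists2 k, i <= k < j & S (x k) && ~~ S (x k.+1).
Proof.
move=> /subnKC <-; elim: (j - i) => [|m IH] Si Sj.
  by move: Sj; rewrite addn0 Si.
have [Sm|Sm] := boolP (S (x (i + m))); last first.
  by have [k ik Sk] := IH Si Sm; exists k => //; lia.
by exists (i + m); [lia | rewrite Sm -addnS].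
Qed.

(** A certificate that [e] is a tree: every edge joins a vertex to its parent [p], and the depth [d]
    decreases along [p] down to the root. *)
Definition rooted_by (V : eqType) (e : rel V) (r : V) (p : V -> V) (d : V -> nat) :=
  [/\ d r = 0, forall v, v != r -> d v = (d (p v)).+1
    & forall x y, e x y = (y != r) && (x == p y) || (x != r) && (y == p x)].

(** Used in both directions, it shows that the depth depends only on the tree and its root. The
    induction follows [p']: by [e], the vertex [p' v] is either the [p]-parent of [v] or one of its
    [p]-children, and [d v] is bounded in both cases. *)
Lemma rooted_by_depth_le (V : eqType) (e : rel V) r p d p' d' :
  rooted_by e r p d -> rooted_by e r p' d' -> forall v, d v <= d' v.
Proof.
move=> [dr dp ep] [dr' dp' ep'] v; elim: {v}(d' v) {-2}v (erefl (d' v)) => [|m IH] v E.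
  have [->|vr] := eqVneq v r; first by rewrite dr.
  by move: E; rewrite dp'.
have [->|vr] := eqVneq v r; first by rewrite dr.
have Em : d' (p' v) = m by move: E; rewrite dp' // => -[].
have: e (p' v) v by rewrite ep' vr eqxx.
have {IH} := IH _ Em; set w := p' v; rewrite ep => L /orP[/andP[_ /eqP Ew]|].
  by rewrite E dp // -Ew ltnS -Em.
move=> /andP[/dp wE /eqP vE]; rewrite E vE.
by move: L; rewrite -/w in Em; rewrite wE Em; lia.
Qed.

Section Rooted.

Variables (V : finType) (e : rel V) (r : V) (p : V -> V) (d : V -> nat).
Hypothesis rooted : rooted_by e r p d.

Let dr : d r = 0. Proof. by case: rooted. Qed.
Let dp v : v != r -> d v = (d (p v)).+1. Proof. by case: rooted => _ + _; apply. Qed.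
Let eE x y : e x y = (y != r) && (x == p y) || (x != r) && (y == p x).
Proof. by case: rooted. Qed.

Lemma rooted_sym : symmetric e.
Proof. by move=> x y; rewrite !eE orbC. Qed.

Lemma adj_depth x y : e x y -> (d x < d y) = (y != r) && (x == p y).
Proof.
rewrite eE; case: (boolP ((y != r) && (x == p y))) => [/andP[yr /eqP->]|_] /=.
  by rewrite [d y]dp // ltnSn.
by case/andP=> /dp-> /eqP->; apply/negbTE; lia.
Qed.

Lemma adj_depthN x y : e x y -> ~~ (d x < d y) -> (x != r) && (y == p x).
Proof. by move=> exy; rewrite adj_depth //; move: exy; rewrite eE => /orP[->|]. Qed.

Definition descendant (v z : V) : bool :=
  (d v <= d z) && (iter (d z - d v) p z == v).

Lemma descendantxx v : descendant v v.
Proof. by rewrite /descendant leqnn subnn /=. Qed.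

Lemma descendant_depth v z : d z = d v -> descendant v z = (z == v).
Proof. by move=> E; rewrite /descendant E leqnn subnn. Qed.

Lemma descendantNlt v z : d z < d v -> ~~ descendant v z.
Proof. by rewrite /descendant ltnNge => /negPf->. Qed.

Lemma descendant_parent v z : z != r -> d v < d z -> descendant v z = descendant v (p z).
Proof.
by move=> zr; rewrite /descendant [d z]dp // ltnS => L; rewrite L leqW // subSn // iterSr.
Qed.

(** The edge from [v] to its parent is the only bridge between the subtree at [v] and the rest. All
    arguments on walks below use acyclicity in this form. *)
Lemma descendant_exit v z z' : e z z' -> descendant v z -> ~~ descendant v z' ->
  z = v /\ z' = p v.
Proof.
have up x : x != r -> descendant v x -> ~~ descendant v (p x) -> x = v.
  move=> xr vx; have [lt|ge] := ltnP (d v) (d x).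
    by rewrite -descendant_parent // vx.
  have dx : d x = d v by case/andP: vx; lia.
  by move: vx; rewrite descendant_depth // => /eqP.
rewrite eE => /orP[/andP[z'r /eqP->] vz|/andP[zr /eqP->] vz vz'].
  rewrite descendant_parent ?vz // [d z']dp // ltnS.
  by case/andP: vz.
by rewrite (up _ zr vz vz').
Qed.

Lemma exit_descendants (x : nat -> V) v i j : (forall k, e (x k) (x k.+1)) -> i <= j ->
  descendant v (x i) -> ~~ descendant v (x j) ->
  exists2 k, i <= k < j & x k = v /\ x k.+1 = p v.
Proof.
move=> ex ij vi vj; have [k ikj /andP[vk vk1]] := crossing ij vi vj.
by exists k => //; apply: descendant_exit (ex k) vk vk1.
Qed.

Lemma enter_descendants (x : nat -> V) v i j : (forall k, e (x k) (x k.+1)) -> i <= j ->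
  ~~ descendant v (x i) -> descendant v (x j) ->
  exists2 k, i <= k < j & x k = p v /\ x k.+1 = v.
Proof.
move=> ex ij vi vj.
have [|k ikj /andP[vk vk1]] := @crossing _ (predC (descendant v)) _ _ _ ij vi.
  by rewrite /= negbK.
exists k => //; move: vk1; rewrite /= negbK => vk1.
by have [] := descendant_exit _ vk1 vk; first by rewrite rooted_sym ex.
Qed.

Lemma stay_descendant (x : nat -> V) v i j : (forall k, e (x k) (x k.+1)) -> i <= j ->
  descendant v (x i) -> (forall k, i <= k <= j -> d v <= d (x k)) ->
  v != r -> descendant v (x j).
Proof.
move=> ex ij vi H vr; apply: contraT => vj.
have [k ikj [_ xk]] := exit_descendants ex ij vi vj.
have kj : i <= k.+1 <= j by lia.
by have := H _ kj; rewrite xk (dp vr) ltnn.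
Qed.

Lemma card_up_darts :
  #|[set q : V * V | e q.1 q.2 && (d q.1 < d q.2)]| = #|V|.-1.
Proof.
have inj : injective (fun v => (p v, v)) by move=> u v [].
rewrite -(cardsC1 r) -(card_imset _ inj); apply: eq_card => -[x y]; rewrite !inE /=.
apply/andP/imsetP => [[exy]|[v + [-> ->]]].
  by rewrite adj_depth // => /andP[yr /eqP->]; exists y; rewrite ?inE.
by rewrite !inE => vr; rewrite eE vr eqxx [d v]dp // ltnSn.
Qed.

Lemma card_darts : #|[set q : V * V | e q.1 q.2]| = (#|V|.-1).*2.
Proof.
pose U := [set q : V * V | e q.1 q.2 && (d q.1 < d q.2)].
pose sw (q : V * V) := (q.2, q.1).
have swinj : injective sw by move=> [x y] [z t] [-> ->].
rewrite -(cardsID U) -addnn; congr (_ + _); rewrite -card_up_darts.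
  by apply: eq_card => q; rewrite !inE; case: (e _ _).
rewrite -[RHS](card_imset _ swinj); apply: eq_card => -[x y]; rewrite !inE /=.
apply/andP/imsetP => [[+ exy]|[[u v] + [-> ->]]]; rewrite ?exy ?inE /=.
  move=> /(adj_depthN exy)/andP[xr /eqP yp]; exists (y, x) => //.
  by rewrite inE rooted_sym exy yp [d x]dp // ltnSn.
by rewrite rooted_sym => /andP[-> L]; rewrite -leqNgt ltnW.
Qed.

Lemma rooted_connect x y : connect e x y.
Proof.
have up v : connect e r v.
  elim: {v}(d v) {-2}v (erefl (d v)) => [|m IH] v E.
    by have [->//|vr] := eqVneq v r; move: E; rewrite dp.
  have [->//|vr] := eqVneq v r; apply: (connect_trans (IH (p v) _)).
    by move: E; rewrite dp // => -[].
  by apply: connect1; rewrite eE vr eqxx.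
apply: connect_trans (up y); by rewrite (sym_connect_sym rooted_sym).
Qed.

End Rooted.

Lemma eq_set2 (T : finType) (x y a b : T) :
  [set x; y] = [set a; b] -> (x = a /\ y = b) \/ (x = b /\ y = a).
Proof.
move=> E; have := set21 a b; have := set22 a b; rewrite -{1 2}E.
have := set21 x y; have := set22 x y; rewrite {1 2}E !inE.
by do 4![case/orP=> /eqP ?]; subst; auto.
Qed.

(** Take for [d] the distance to [r] and for [p] the predecessor on a shortest path. The edges from
    non-root vertices to their parents are distinct, by depth, and there are [#|V|.-1] of them, so
    they exhaust [E]. *)
Lemma tree_rooted (V : finType) (E : {set {set V}}) (e : rel V) (r : V) :
  (forall x y, e x y = ([set x; y] \in E)) ->
  (forall x y, connect e x y) -> #|E| = #|V|.-1 ->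
  exists p d, rooted_by e r p d.
Proof.
move=> eE conn cE.
have esym x y : e x y = e y x by rewrite !eE setUC.
have /fin_all_exists[d dP] : forall v, exists k,
    (exists2 s, path e r s & last r s = v /\ size s = k) /\
    (forall s, path e r s -> last r s = v -> k <= size s).
  move=> v.
  pose P k := [exists s : k.-tuple V, path e r s && (last r s == v)].
  have exP : exists k, P k.
    have /connectP[s es vE] := conn r v; exists (size s).
    by apply/existsP; exists (in_tuple s); rewrite es vE eqxx.
  exists (ex_minn exP); case: ex_minnP => k /existsP[s /andP[es /eqP ls]] kmin.
  split; first by exists s; rewrite ?size_tuple.
  move=> s' es' ls'; apply: kmin; apply/existsP; exists (in_tuple s').
  by rewrite es' ls' eqxx.
have d_adj u v : e u v -> d v <= (d u).+1.
  move=> euv; have [[s es [ls <-]] _] := dP u; have [_ H] := dP v.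
  by have := H (rcons s v); rewrite rcons_path es ls last_rcons size_rcons; apply.
have /fin_all_exists[p pP] : forall v, exists u, v != r -> e u v /\ d v = (d u).+1.
  move=> v; have [->|vr] := eqVneq v r; first by exists r.
  have [[s es [ls ds]] _] := dP v; case/lastP: s es ls ds => [|s w].
    by move=> _ /= rv; rewrite rv eqxx in vr.
  rewrite rcons_path last_rcons size_rcons => /andP[es ew] wv ds; rewrite wv in ew.
  exists (last r s); split=> //; have := d_adj _ _ ew.
  by have [_ /(_ s es erefl)] := dP (last r s); lia.
have dr : d r = 0.
  by have [_ /(_ [::] isT erefl)] := dP r; case: (d r).
exists p, d; split=> // [v /pP[]//|x y].
pose c v := [set p v; v].
have cinj : {in [set~ r] &, injective c}.
  move=> u v; rewrite !inE => ur vr /eq_set2[[_ //]|[E1 E2']].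
  by have [_] := pP _ ur; have [_] := pP _ vr; rewrite E1 -E2'; lia.
have cE' : c @: [set~ r] = E.
  apply/eqP; rewrite eqEcard card_in_imset // cardsC1 cE leqnn andbT.
  by apply/subsetP => s /imsetP[v]; rewrite !inE => /pP[+ _] ->; rewrite eE.
apply/idP/idP => [|/orP[/andP[yr /eqP->]|/andP[xr /eqP->]]]; last first.
- by rewrite esym; have [] := pP x xr.
- by have [] := pP y yr.
rewrite eE -cE' => /imsetP[v]; rewrite !inE => vr /eq_set2[] [-> ->].
  by rewrite vr eqxx.
by rewrite vr eqxx orbT.
Qed.

Section Contour.

Variables (V : finType) (e : rel V) (r : V) (p : V -> V) (d : V -> nat).
Variable R : V -> {perm V}.
Hypothesis rooted : rooted_by e r p d.
Hypothesis R_on : forall x, perm_on [set y | e x y] (R x).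
Hypothesis R_cycle : forall x y, e x y -> porbit (R x) y = [set z | e x z].

(* Tracing the boundary of the (unique) face of the plane tree. *)
Definition next_dart (q : V * V) : V * V := (q.2, R q.2 q.1).

Lemma next_dart_inj : injective next_dart.
Proof. by move=> [x y] [x' y'] [<-] /perm_inj->. Qed.

Let e_sym := rooted_sym rooted.

Lemma next_dart_adj q : e q.1 q.2 -> e (next_dart q).1 (next_dart q).2.
Proof.
case: q => x y /= exy; have := perm_closed x (R_on y).
by rewrite !inE [e y x]e_sym exy.
Qed.

Variable y0 : V.
Hypothesis y0_adj : e r y0.

(** The first neighbour [y0] is arbitrary, the edges at the root having only a cyclic order. *)
Definition contour (i : nat) : V * V := iter i next_dart (r, y0).
Definition walker (i : nat) : V := (contour i).1.

Lemma contourE i : contour i = (walker i, walker i.+1).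
Proof. by rewrite /walker /=; case: (contour i). Qed.

Lemma walker0 : walker 0 = r. Proof. by []. Qed.

Lemma walker_adj i : e (walker i) (walker i.+1).
Proof.
suff: e (contour i).1 (contour i).2 by rewrite contourE.
by elim: i => [//|i IH]; apply: next_dart_adj.
Qed.

Let M := fingraph.order next_dart (r, y0).

Let contourM i : contour (M + i) = contour i.
Proof. by rewrite addnC /contour iterD (iter_order next_dart_inj). Qed.

Let walkerM i : walker (M + i) = walker i.
Proof. by rewrite /walker contourM. Qed.

(* A closed walk that crosses an edge of a tree must cross it back. *)
Let rev_contour i : exists j, contour j = (walker i.+1, walker i).
Proof.
have [_ dp eE] := rooted; have M0 : 0 < M by apply: fingraph.order_gt0.
have iM : i < M + i by lia.
have := walker_adj i; rewrite eE => /orP[/andP[vr /eqP wi]|/andP[vr /eqP wi]].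
  have [||k _ [xk xk1]] := exit_descendants rooted walker_adj iM (v := walker i.+1).
  - exact: descendantxx.
  - by rewrite walkerM wi descendantNlt // (dp _ vr).
  by exists k; rewrite contourE xk xk1 -wi.
have [||k _ [xk xk1]] := enter_descendants rooted walker_adj iM (v := walker i).
- by rewrite wi descendantNlt // (dp _ vr).
- by rewrite walkerM descendantxx.
by exists k; rewrite contourE xk xk1 wi.
Qed.

(** If the dart from x to z is traced, so is its reverse, whose successor is the dart from x to
    [R x z]. Since [R x] is a single cycle on the neighbours, all darts out of x follow. *)
Let contour_vertex i x y : contour i = (x, y) ->
  forall z, e x z -> exists j, contour j = (x, z).
Proof.
move=> E z exz; have exy : e x y.
  by have := walker_adj i; move: E; rewrite contourE => -[-> ->].
have : z \in porbit (R x) y by rewrite R_cycle // inE.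
case/porbitP=> k ->; elim: k => [|k [j Ej]]; first by exists i; rewrite expg0 perm1.
have [j' Ej'] := rev_contour j; exists j'.+1.
rewrite expgSr permM; move: Ej; rewrite contourE => -[Ej1 Ej2].
by rewrite [contour _]/= -/(contour j') Ej' /next_dart /= Ej1 Ej2.
Qed.

(** Being fully traced passes from a vertex to its neighbours through [rev_contour], hence along a
    path from the root. *)
Lemma contour_surj x y : e x y -> exists i, contour i = (x, y).
Proof.
pose Q x := forall y, e x y -> exists i, contour i = (x, y).
suff: Q x by apply.
have /connectP[s es ->] := rooted_connect rooted r x.
have: Q r by apply: (@contour_vertex 0 r y0).
elim: s (r) es => [//|z s IH] u /= /andP[euz es] Qu; apply: IH => //.
have [i] := Qu _ euz; rewrite contourE => -[E1 E2].
have [j] := rev_contour i; rewrite E1 E2; exact: contour_vertex.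
Qed.

Lemma order_next_dart : M = (#|V|.-1).*2.
Proof.
rewrite -(card_darts rooted) /M /fingraph.order; apply: eq_card => -[x y].
rewrite [RHS]inE /=; apply/idP/idP => [q|exy].
  by have := walker_adj (findex next_dart (r, y0) (x, y));
     rewrite /walker /contour iterS iter_findex.
by have [i <-] := contour_surj exy; apply: fconnect_iter.
Qed.

Lemma contour_period i : contour ((#|V|.-1).*2 + i) = contour i.
Proof. by rewrite -order_next_dart contourM. Qed.

Lemma walker_period i : walker ((#|V|.-1).*2 + i) = walker i.
Proof. by rewrite -order_next_dart walkerM. Qed.

Lemma contour_mod i : contour (i %% (#|V|.-1).*2) = contour i.
Proof.
rewrite [in RHS](divn_eq i (#|V|.-1).*2); elim: (i %/ _) => [//|q IH].
by rewrite mulSn -addnA contour_period.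
Qed.

Lemma contour_inj i j : i < (#|V|.-1).*2 -> j < (#|V|.-1).*2 ->
  contour i = contour j -> i = j.
Proof.
rewrite -order_next_dart => iM jM E.
by rewrite -(findex_iter iM) -(findex_iter jM) -!/(contour _) E.
Qed.

(** Let v be the vertex at time i. Dipping below its depth between two visits would mean entering
    its subtree again by the dart from [p v], already used before time i as the walk starts at the
    root; a dart is used once per period. Conversely, a walk that stays at least as deep as v stays
    in its subtree, where v is alone at its depth. *)
Lemma walker_eq i j : i <= j < (#|V|.-1).*2 ->
  (walker i == walker j) = (d (walker j) == d (walker i)) &&
     all (fun k => d (walker i) <= d (walker k)) (index_iota i j.+1).
Proof.
have [dr dp eE] := rooted; case/andP=> ij jM.
apply/eqP/andP => [E|[/eqP dE /allP H]]; last first.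
  have [wr|wr] := eqVneq (walker i) r.
    rewrite wr; apply/esym/eqP; apply: contraT => jr.
    by move: dE; rewrite wr dr (dp _ jr).
  apply/esym/eqP; rewrite -(descendant_depth p dE).
  apply: (stay_descendant rooted walker_adj ij) => //.
    exact: descendantxx.
  by move=> k ikj; apply: H; rewrite mem_index_iota.
split; first by rewrite E.
apply/allP => k; rewrite mem_index_iota ltnS => /andP[ik kj].
rewrite leqNgt; apply/negP => lt; set v := walker i in E lt.
have vr : v != r by apply: contraTneq lt => ->; rewrite dr.
have nk := descendantNlt p lt.
have [|k1 /andP[kk1 k1j] [w1 w1']] :=
  enter_descendants rooted walker_adj kj nk; first by rewrite -E descendantxx.
have [||k2 /andP[_ k2i] [w2 w2']] := enter_descendants rooted walker_adj (leq0n i) (v := v).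
- by rewrite walker0 descendantNlt // dr (dp _ vr).
- exact: descendantxx.
have /contour_inj : contour k1 = contour k2 by rewrite !contourE w1 w1' w2 w2'.
by lia.
Qed.

End Contour.

(** * Contour codes of plane trees *)

Lemma adjacent_sym n (t : plane_structure n) : symmetric (adjacent t).
Proof. by move=> x y; rewrite /adjacent /= setUC. Qed.

Section Codes.

Variables (n N : nat).
Hypothesis Nn : N.+1 = 2 * n.

Local Notation word := {ffun 'I_N.+1 -> bool}.
Local Notation V := 'I_n.+1.
Implicit Types (t u : plane_structure n) (w : word).

Let n_gt0 : 0 < n. Proof. by case: (n) Nn. Qed.
Let period : N.+1 = (#|V|.-1).*2. Proof. by rewrite card_ord /= Nn mul2n. Qed.

Definition tree_walker t (y0 : V) : nat -> V :=
  walker (root_vertex t) (rotation t) y0.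
Definition tree_contour t (y0 : V) : nat -> V * V :=
  contour (root_vertex t) (rotation t) y0.

(* w records the ups and downs of the depth along a contour walk from the root. *)
Definition has_code t w : Prop := exists y0 p d,
  [/\ rooted_by (adjacent t) (root_vertex t) p d, adjacent t (root_vertex t) y0
    & forall i, per w i = (d (tree_walker t y0 i) < d (tree_walker t y0 i.+1))].

Section PlaneTree.

Variable t : plane_structure n.
Hypothesis plane_t : is_plane_tree t.

Lemma plane_tree_rooted : exists p d, rooted_by (adjacent t) (root_vertex t) p d.
Proof.
case/andP: plane_t => /and3P[_ /forallP conn /eqP cE] _.
apply: (@tree_rooted _ (edges t)) => // [x y|]; last by rewrite card_ord.
by move/forallP: (conn x).
Qed.

Lemma plane_tree_perm_on x : perm_on [set y | adjacent t x y] (rotation t x).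
Proof. by case/andP: plane_t => _ /forallP/(_ x)/andP[]. Qed.

Lemma plane_tree_porbit x y : adjacent t x y ->
  porbit (rotation t x) y = [set z | adjacent t x z].
Proof.
case/andP: plane_t => _ /forallP/(_ x)/andP[_ /forallP/(_ y)].
by rewrite inE => /implyP H /H/eqP.
Qed.

Variables (y0 : V) (p : V -> V) (d : V -> nat).
Hypothesis rooted : rooted_by (adjacent t) (root_vertex t) p d.
Hypothesis y0_adj : adjacent t (root_vertex t) y0.

Let x := tree_walker t y0.

Lemma tree_walker_adj i : adjacent t (x i) (x i.+1).
Proof. exact: (walker_adj rooted plane_tree_perm_on y0_adj). Qed.

Lemma tree_walkerSS i : x i.+2 = rotation t (x i.+1) (x i).
Proof. by []. Qed.

Lemma tree_contour_surj a b : adjacent t a b ->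
  exists2 i, i < N.+1 & (x i, x i.+1) = (a, b).
Proof.
move=> ab; have := contour_surj rooted plane_tree_perm_on plane_tree_porbit y0_adj ab.
case=> i <-; exists (i %% N.+1); first by rewrite ltn_mod.
rewrite -contourE period.
exact: (contour_mod rooted plane_tree_perm_on plane_tree_porbit y0_adj).
Qed.

Lemma tree_contour_inj i j : i < N.+1 -> j < N.+1 ->
  (x i, x i.+1) = (x j, x j.+1) -> i = j.
Proof.
rewrite -!contourE period.
exact: (contour_inj rooted plane_tree_perm_on plane_tree_porbit y0_adj).
Qed.

Lemma tree_walker_period i : x (N.+1 + i) = x i.
Proof.
by rewrite period;
   exact: (walker_period rooted plane_tree_perm_on plane_tree_porbit y0_adj).
Qed.

Lemma tree_walker_mod i : x (i %% N.+1) = x i.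
Proof.
rewrite [in RHS](divn_eq i N.+1); elim: (i %/ _) => [//|q IH].
by rewrite mulSn -addnA tree_walker_period.
Qed.

Lemma tree_walker_surj v : exists2 i, i < N.+1 & x i = v.
Proof.
have [b vb] : exists b, adjacent t v b.
  have [->|vr] := eqVneq v (root_vertex t); first by exists y0.
  by exists (p v); have [_ _ ->] := rooted; rewrite vr eqxx orbT.
by have [i iN [<- _]] := tree_contour_surj vb; exists i.
Qed.

Lemma tree_walker_eq i j : i <= j < N.+1 ->
  (x i == x j) = (d (x j) == d (x i)) &&
     all (fun k => d (x i) <= d (x k)) (index_iota i j.+1).
Proof.
rewrite period.
exact: (walker_eq rooted plane_tree_perm_on plane_tree_porbit y0_adj).
Qed.

Lemma tree_walker_step i b : b = (d (x i) < d (x i.+1)) ->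
  d (x i.+1) + ~~ b = d (x i) + b.
Proof.
have [_ dp _] := rooted; have ai := tree_walker_adj i.
case: b => /esym H.
  have := adj_depth rooted ai; rewrite H => /esym/andP[/dp-> /eqP<-].
  by rewrite addn0 addn1.
by have /andP[/dp-> /eqP->] := adj_depthN rooted ai (negbT H); rewrite addn0 addn1.
Qed.

End PlaneTree.

Lemma has_code_exists t : is_plane_tree t -> exists w, has_code t w.
Proof.
move=> pt; have [p [d rooted]] := plane_tree_rooted pt.
have [y0 ry] : exists y, adjacent t (root_vertex t) y.
  have [v vr] : exists v : V, v != root_vertex t.
    have : 0 < #|[set~ root_vertex t]| by rewrite cardsC1 card_ord.
    by case/card_gt0P=> v; rewrite !inE; exists v.
  have /connectP[[|y s] /= es ve] := rooted_connect rooted (root_vertex t) v.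
    by rewrite ve eqxx in vr.
  by exists y; case/andP: es.
pose x := tree_walker t y0.
exists [ffun i : 'I_N.+1 => d (x i) < d (x i.+1)], y0, p, d; split=> // i.
have xm : forall i, x (i %% N.+1) = x i := tree_walker_mod pt rooted ry.
have xmS : x (i %% N.+1).+1 = x i.+1.
  by rewrite -xm -[RHS]xm; congr x; exact: (modnDmr 1 i N.+1).
by rewrite /per ffunE /= xm xmS.
Qed.

(** The ups of a period correspond to the darts leading away from the root, one for each of the n
    other vertices. *)
Lemma has_code_balanced t w : is_plane_tree t -> has_code t w -> w \in balanced N n.
Proof.
move=> pt [y0 [p [d [rooted ry wE]]]]; rewrite inE; apply/eqP.
pose x := tree_walker t y0; pose c (i : 'I_N.+1) := (x i, x i.+1).
have wE' (i : 'I_N.+1) : w i = (d (x i) < d (x i.+1)) by rewrite -wE per_ord.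
have := card_up_darts rooted; rewrite card_ord /= => <-.
transitivity #|[set i : 'I_N.+1 | w i]|.
  by rewrite -sum1_card [RHS]big_mkcond; apply: eq_bigr => i _; rewrite inE; case: (w i).
have cinj : injective c.
  move=> i j E; apply/val_inj.
  exact: (tree_contour_inj pt rooted ry (ltn_ord i) (ltn_ord j) E).
rewrite -(card_imset _ cinj); apply: eq_card => q; rewrite [RHS]inE.
apply/imsetP/idP => [[i + ->]|/andP[eq lt]].
  by rewrite inE wE' => H; rewrite /c H (tree_walker_adj pt rooted ry).
have [i iN E] := tree_contour_surj pt rooted ry eq.
have E' : q = c (Ordinal iN) by rewrite /c E; case: (q).
by exists (Ordinal iN); rewrite // inE wE' /= -[x i]/(c (Ordinal iN)).1
   -[x i.+1]/(c (Ordinal iN)).2 -E'.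
Qed.

Lemma contourD t y0 y1 k i : tree_walker t y0 k = root_vertex t ->
  tree_walker t y0 k.+1 = y1 -> tree_walker t y0 (i + k) = tree_walker t y1 i.
Proof.
move=> E0 E1; rewrite /tree_walker /walker /contour iterD.
by rewrite -[iter k _ _]/(contour _ _ _ k) contourE -/(tree_walker _ _) E0 E1.
Qed.

(** The first contour walk traverses at some time the initial dart of the second, and the two agree
    from there on. The depths agree by uniqueness. *)
Lemma has_code_rotation t w w' : is_plane_tree t -> has_code t w -> has_code t w' ->
  w' \in rotations w.
Proof.
move=> pt [y0 [p [d [rt ry wE]]]] [y1 [p' [d' [rt' ry' wE']]]].
have dd v : d' v = d v.
  by apply/eqP; rewrite eqn_leq !(rooted_by_depth_le rt rt', rooted_by_depth_le rt' rt).
have [k _ [k0 k1]] := tree_contour_surj pt rt ry ry'.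
by apply/rotateP; exists k => i; rewrite wE' wE !dd -addSn !(contourD _ k0 k1).
Qed.

(* Both words being codes, their walks stay nonnegative, so the rotation must
   start at another visit to the root. *)
Lemma has_code_rotate t u w w' : is_plane_tree t -> is_plane_tree u ->
  has_code t w -> has_code u w' -> w' \in rotations w -> has_code t w'.
Proof.
move=> pt pu [y0 [p [d [rt ry wE]]]] [y1 [p' [d' [ru ru' wE']]]] /rotateP[k wk].
pose x := tree_walker t y0; pose x' := tree_walker u y1.
have H i : d' (x' i) + d (x k) = d (x (i + k)).
  elim: i => [|i IH]; first by have [-> _ _] := ru; rewrite !add0n.
  have := tree_walker_step pt rt ry (wE (i + k)); rewrite -wk -/x addSn.
  by have := tree_walker_step pu ru ru' (wE' i); rewrite -/x'; lia.
have xk : x k = root_vertex t.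
  (* The time [k * N] is chosen so that adding [k] gives a multiple of [N.+1], where the first walk
     is at the root; [H] then forces depth 0 at time [k]. *)
  have xN : x (k * N + k) = root_vertex t.
    have -> : k * N + k = k * N.+1 by rewrite mulnS addnC.
    by rewrite /x -(tree_walker_mod pt rt ry) modnMl.
  have [dr dp _] := rt; have := H (k * N); rewrite xN dr.
  by have [//|/dp->] := eqVneq (x k) (root_vertex t); rewrite addnS.
exists (x k.+1), p, d; split=> // [|i].
  by rewrite -xk (tree_walker_adj pt rt ry).
by rewrite wk wE -addSn !(@contourD t y0 (x k.+1) k).
Qed.

Lemma has_code_iso t u w : is_plane_tree t -> plane_iso t u -> has_code t w ->
  has_code u w.
Proof.
move=> pt /plane_isoP[h [hr ha hs]] [y0 [p [d [rt ry wE]]]].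
have xE i : tree_walker u (h y0) i = h (tree_walker t y0 i).
  suff: tree_contour u (h y0) i = (h (tree_walker t y0 i), h (tree_walker t y0 i.+1)).
    by rewrite /tree_contour contourE => -[].
  elim: i => [|i IH]; first by rewrite /tree_contour /= -hr.
  rewrite /tree_contour /= -/(tree_contour u (h y0) i) IH /next_dart /=.
  by rewrite -hs ?(tree_walkerSS t) // adjacent_sym (tree_walker_adj pt rt ry).
have [dr dp eE] := rt.
exists (h y0), (fun v => h (p (h^-1 v)%g)), (fun v => d (h^-1 v)%g); split.
- split=> [|v vr|a b]; first by rewrite -hr permK.
    by rewrite permK dp //; apply: contraNneq vr => hv; rewrite -hr -hv permKV.
  rewrite -{1}[a](permKV h) -{1}[b](permKV h) ha eE -hr.
  by rewrite !(can2_eq (permKV h) (permK h)).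
- by rewrite -hr ha.
by move=> i; rewrite !xE !permK.
Qed.

(* By tree_walker_eq, the depths decide when two times visit the same vertex. *)
Lemma same_code_iso t u w : is_plane_tree t -> is_plane_tree u ->
  has_code t w -> has_code u w -> plane_iso t u.
Proof.
move=> pt pu [y0 [p [d [rt ry wE]]]] [y1 [p' [d' [ru ru' wE']]]].
pose x := tree_walker t y0; pose x' := tree_walker u y1.
have dd i : d' (x' i) = d (x i).
  elim: i => [|i IH]; first by have [-> _ _] := ru; have [-> _ _] := rt.
  have := tree_walker_step pt rt ry (wE i); rewrite -/x.
  by have := tree_walker_step pu ru ru' (wE' i); rewrite -/x'; lia.
have xx i j : (x i == x j) = (x' i == x' j).
  wlog ij : i j / i %% N.+1 <= j %% N.+1.
    by move=> W; have [/W//|/ltnW/W] := leqP (i %% N.+1) (j %% N.+1); rewrite eq_sym => ->.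
  have xm k : x (k %% N.+1) = x k := tree_walker_mod pt rt ry k.
  have xm' k : x' (k %% N.+1) = x' k := tree_walker_mod pu ru ru' k.
  rewrite -(xm i) -(xm j) -(xm' i) -(xm' j).
  have ijN : i %% N.+1 <= j %% N.+1 < N.+1 by rewrite ij ltn_mod.
  have := tree_walker_eq pt rt ry ijN; rewrite -/x => ->.
  have := tree_walker_eq pu ru ru' ijN; rewrite -/x' !dd => ->.
  by congr (_ && _); apply: eq_all => k; rewrite !dd.
have /fin_all_exists[idx xidx] : forall v, exists i, x i = v.
  by move=> v; have [i _ <-] := tree_walker_surj pt rt ry v; exists i.
(* By [xx] this does not depend on the chosen visiting time, and it is injective. *)
pose h0 v := x' (idx v).
have h0x i : h0 (x i) = x' i by apply/eqP; rewrite /h0 -xx xidx.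
have h0inj : injective h0.
  by move=> a b /eqP; rewrite -xx !xidx => /eqP.
apply/plane_isoP; exists (perm h0inj).
have adj a b : adjacent u (h0 a) (h0 b) = adjacent t a b.
  apply/idP/idP => ab.
    have [i _ [Ea Eb]] := tree_contour_surj pu ru ru' ab.
    have hx c k : x' k = h0 c -> c = x k.
      by move=> E; apply: h0inj; rewrite h0x.
    by rewrite (hx a _ Ea) (hx b _ Eb); apply: (tree_walker_adj pt rt ry).
  have [i _ [Ea Eb]] := tree_contour_surj pt rt ry ab.
  rewrite -Ea -Eb -!/(x _).
  by rewrite !h0x; apply: (tree_walker_adj pu ru ru').
split=> [|a b|a b ab]; rewrite ?permE //; first exact: (h0x 0).
rewrite adjacent_sym in ab; have [i _ [Eb Ea]] := tree_contour_surj pt rt ry ab.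
rewrite -Ea -Eb -!tree_walkerSS -!/(x _) !h0x.
exact: tree_walkerSS.
Qed.

End Codes.

(** * The plane tree of a Dyck word *)

Definition num_ups (b : nat -> bool) (k : nat) : nat := \sum_(i < k) b i.

Lemma num_upsS b k : num_ups b k.+1 = num_ups b k + b k.
Proof. by rewrite /num_ups big_ord_recr. Qed.

Lemma num_ups_mono b i j : i <= j -> num_ups b i <= num_ups b j.
Proof.
move=> /subnKC<-; elim: (j - i) => [|m IH]; first by rewrite addn0.
by rewrite addnS num_upsS; apply: leq_trans IH (leq_addr _ _).
Qed.

Section DyckTree.

Variables (n : nat) (b : nat -> bool).
Local Notation V := 'I_n.+1.
Local Notation M := (2 * n).

Hypothesis n_gt0 : 0 < n.
Hypothesis b_period : forall i, b (i %% M) = b i.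
Hypothesis bM : num_ups b M = n.
Hypothesis b_ge0 : forall k, k <= M -> k <= 2 * num_ups b k.

(** The height after [k] steps; by [b_ge0] the subtraction is exact for [k <= M]. *)
Let H (k : nat) : nat := 2 * num_ups b k - k.

Let H_up k : k < M -> b k -> H k.+1 = (H k).+1.
Proof. by rewrite /H num_upsS => kM ->; have := b_ge0 (ltnW kM); lia. Qed.

Let H_down k : k < M -> ~~ b k -> H k = (H k.+1).+1.
Proof. by rewrite /H num_upsS => kM /negPf E; have := b_ge0 kM; rewrite num_upsS E; lia. Qed.

Lemma exists_up_time (v : V) : exists j, v != ord0 -> [/\ j < M, b j & num_ups b j.+1 = v].
Proof.
have [->|v0] := eqVneq v ord0; first by exists 0.
have v_gt0 : 0 < v by rewrite lt0n.
have [||k /andP[_ kM] /andP[/= Uk UkS]] := @crossing _ (fun m => m < v) (num_ups b) 0 M isT.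
- by rewrite /num_ups big_ord0.
- by rewrite -leqNgt bM -ltnS.
exists k => _; move: Uk UkS; rewrite num_upsS; case: (b k) => /=; last by lia.
by split=> //; lia.
Qed.

Variable up_time : V -> nat.
Hypothesis up_timeP : forall v : V, v != ord0 ->
  [/\ up_time v < M, b (up_time v) & num_ups b (up_time v).+1 = v].

Let up_time_uniq (v : V) j : v != ord0 -> b j -> num_ups b j.+1 = v -> up_time v = j.
Proof.
move=> v0 bj Uj; have [_ bt Ut] := up_timeP v0.
have := num_upsS b j; have := num_upsS b (up_time v); rewrite bj bt Ut Uj => E1 E2.
have [lt|lt|//] := ltngtP (up_time v) j.
  by have := num_ups_mono b lt; rewrite Ut; lia.
by have := num_ups_mono b lt; rewrite Uj; lia.
Qed.

(* The vertices visited up to time k.  A vertex is named after the rank of the up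
   step that discovers it, and a down step returns to where that step started. *)
Fixpoint visits (k : nat) : seq V :=
  if k is k'.+1 then
    let s := visits k' in
    rcons s (if b k' then inord (num_ups b k) else nth ord0 s (up_time (last ord0 s)))
  else [:: ord0].

Definition visit (k : nat) : V := last ord0 (visits k).

Let size_visits k : size (visits k) = k.+1.
Proof. by elim: k => //= k IH; rewrite size_rcons IH. Qed.

Let nth_visits m k : k <= m -> nth ord0 (visits m) k = visit k.
Proof.
elim: m => [|m IH]; first by rewrite leqn0 => /eqP->.
rewrite leq_eqVlt => /predU1P[->|km].
  by rewrite /visit -nth_last size_visits.
by rewrite /= nth_rcons size_visits km IH.
Qed.

Let visit_up k : b k -> visit k.+1 = inord (num_ups b k.+1).
Proof. by rewrite /visit /= last_rcons => ->. Qed.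

Let visit_down k : ~~ b k -> up_time (visit k) <= k -> visit k.+1 = visit (up_time (visit k)).
Proof. by rewrite [visit k.+1]/visit /= last_rcons => /negPf-> /nth_visits. Qed.

(** The invariant behind [visits]: the step that discovered the current vertex lies in the past, so
    the lookup of a down step never falls on the default value, and it started one level lower. The
    induction is strong because a down step refers back to that earlier time. *)
Let visit_height k : k <= M ->
  if visit k == ord0 then H k = 0
  else up_time (visit k) < k /\ H k = (H (up_time (visit k))).+1.
Proof.
elim/ltn_ind: k => -[|k] IH kM; first by rewrite eqxx /H /num_ups big_ord0.
have [bk|bk] := boolP (b k).
  have Un : num_ups b k.+1 <= n by rewrite -[X in _ <= X]bM num_ups_mono.
  have vk : visit k.+1 = num_ups b k.+1 :> nat by rewrite visit_up // inordK.
  have v0 : visit k.+1 != ord0 by rewrite -val_eqE /= vk num_upsS bk addn1.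
  by rewrite (negPf v0) (@up_time_uniq _ k) // H_up.
have := IH k (leqnn _) (ltnW kM); have Hk := H_down kM bk.
case: eqP => [_|/eqP v0 [tk Ht]]; first by lia.
rewrite visit_down // ?(ltnW tk) //.
have Hk1 : H k.+1 = H (up_time (visit k)) by lia.
have := IH (up_time (visit k)) (leq_trans tk (leqnSn _)).
move/(_ (ltnW (leq_trans tk (ltnW kM)))); case: eqP => _; first by rewrite Hk1.
by case=> tt E; rewrite Hk1; split=> //; lia.
Qed.

Definition dyck_parent (v : V) : V := visit (up_time v).
Definition dyck_depth (v : V) : nat := if v == ord0 then 0 else (H (up_time v)).+1.
Definition dyck_adj : rel V := fun u v =>
  (v != ord0) && (u == dyck_parent v) || (u != ord0) && (v == dyck_parent u).

Let depth_visit k : k <= M -> dyck_depth (visit k) = H k.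
Proof.
by move=> kM; have := visit_height kM; rewrite /dyck_depth; case: eqP => [_|_ []].
Qed.

Lemma dyck_rooted : rooted_by dyck_adj ord0 dyck_parent dyck_depth.
Proof.
split=> // v v0; have [tM _ _] := up_timeP v0.
by rewrite /dyck_parent depth_visit ?(ltnW tM) // /dyck_depth (negPf v0).
Qed.

Let visit_adj k : k < M -> dyck_adj (visit k) (visit k.+1).
Proof.
move=> kM; rewrite /dyck_adj; have [bk|bk] := boolP (b k).
  have Un : num_ups b k.+1 <= n by rewrite -[X in _ <= X]bM num_ups_mono.
  have vk : visit k.+1 = num_ups b k.+1 :> nat by rewrite visit_up // inordK.
  have v0 : visit k.+1 != ord0 by rewrite -val_eqE /= vk num_upsS bk addn1.
  by rewrite v0 /dyck_parent (@up_time_uniq _ k) // eqxx.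
have := visit_height (ltnW kM); have Hk := H_down kM bk.
case: eqP => [_|/eqP v0 [tk Ht]]; first by lia.
by rewrite (visit_down bk (ltnW tk)) /= eqxx orbT.
Qed.

Let visitM : visit M = ord0.
Proof.
apply/eqP; apply: contraT => v0; have := depth_visit (leqnn M).
by rewrite /dyck_depth (negPf v0) /H bM subnn.
Qed.

Definition tour (k : nat) : V := visit (k %% M).

Let M_gt0 : 0 < M. Proof. by rewrite muln_gt0. Qed.

Let tourE k : k <= M -> tour k = visit k.
Proof.
rewrite leq_eqVlt /tour => /predU1P[->|/modn_small->//].
by rewrite modnn visitM.
Qed.

Let tour_mod k : tour (k %% M) = tour k.
Proof. by rewrite /tour modn_mod. Qed.

Let tourS k : tour k.+1 = visit (k %% M).+1.
Proof.
have -> : tour k.+1 = tour (k %% M).+1.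
  by rewrite -[LHS]tour_mod -[RHS]tour_mod; congr tour; exact: esym (modnDmr 1 k M).
by rewrite tourE // ltn_mod.
Qed.

Lemma tour_adj k : dyck_adj (tour k) (tour k.+1).
Proof. by rewrite tourS; apply: visit_adj; rewrite ltn_mod. Qed.

Lemma tour_up k : b k = (dyck_depth (tour k) < dyck_depth (tour k.+1)).
Proof.
have kM : k %% M < M by rewrite ltn_mod.
rewrite tourS /tour !depth_visit //; last exact: ltnW.
rewrite -(b_period k).
have [bk|bk] := boolP (b (k %% M)); first by rewrite H_up ?ltnSn.
by rewrite (H_down kM bk); apply/esym/negbTE; lia.
Qed.

(** The dart towards a child is traversed when the child is discovered. The reverse dart is
    traversed later, because the tour must leave the subtree of the child to end at the root. *)
Let tour_surj u v : dyck_adj u v -> exists i : 'I_M, (tour i, tour i.+1) = (u, v).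
Proof.
have [_ dp _] := dyck_rooted.
rewrite /dyck_adj => /orP[/andP[v0 /eqP->]|/andP[u0 /eqP->]].
  have [tM bt Ut] := up_timeP v0; exists (Ordinal tM) => /=.
  rewrite tourE ?(ltnW tM) // tourE // visit_up // Ut inord_val //.
have [tM bt Ut] := up_timeP u0.
have [||k /andP[_ kM] [<- <-]] := exit_descendants dyck_rooted tour_adj tM (v := u).
- by rewrite tourE // visit_up // Ut inord_val descendantxx.
- by rewrite tourE // visitM descendantNlt // (dp _ u0).
by exists (Ordinal kM).
Qed.

(** The [M] times of a period cover all darts, and there are exactly [M] darts. *)
Let tour_inj i j : tour i = tour j -> tour i.+1 = tour j.+1 -> i = j %[mod M].
Proof.
pose c (k : 'I_M) := (tour k, tour k.+1).
have /imset_injP cinj : #|c @: setT| == #|[set: 'I_M]|.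
  rewrite cardsT card_ord; apply/eqP.
  rewrite [RHS]mul2n; have := card_darts dyck_rooted; rewrite card_ord /= => <-.
  apply: eq_card => -[u v]; rewrite [RHS]inE; apply/imsetP/idP => [[k _ [-> ->]]|uv].
    exact: tour_adj.
  by have [k E] := tour_surj uv; exists k.
have iM : i %% M < M by rewrite ltn_mod.
have jM : j %% M < M by rewrite ltn_mod.
have eS k : tour (k %% M).+1 = tour k.+1 by rewrite !tourS modn_mod.
move=> E1 E2; suff /(congr1 val) : Ordinal iM = Ordinal jM by [].
by apply: cinj; rewrite ?inE // /c /= !tour_mod !eS E1 E2.
Qed.

Let dyck_sym := rooted_sym dyck_rooted.

(** The rotation at y is read off the tour: a neighbour from which the tour enters y is sent to the
    one visited next. [tour_inj] makes this well defined and injective; other vertices are fixed. *)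
Lemma exists_dyck_rotation (y : V) : exists R : {perm V},
  (forall i, tour i.+1 = y -> R (tour i) = tour i.+2) /\
  perm_on [set z | dyck_adj y z] R.
Proof.
have /fin_all_exists[f fP] : forall z, exists z',
    if dyck_adj z y then exists i, [/\ tour i = z, tour i.+1 = y & tour i.+2 = z']
    else z' = z.
  move=> z; have [zy|_] := boolP (dyck_adj z y); last by exists z.
  by have [i [<- <-]] := tour_surj zy; exists (tour i.+2), i.
have fadj z : dyck_adj z y -> dyck_adj (f z) y.
  by move=> zy; have := fP z; rewrite zy => -[i [_ <- <-]]; rewrite dyck_sym tour_adj.
have finj : injective f.
  move=> z z' E; have := fP z; have := fP z'; rewrite -E.
  have [zy|zy] /= := boolP (dyck_adj z y); have [zy'|zy'] /= := boolP (dyck_adj z' y).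
  - move=> [j [Ej1 Ej2 Ej3]] [i [Ei1 Ei2 Ei3]]; rewrite -Ei1 -Ej1 -tour_mod -[RHS]tour_mod.
    congr tour; apply/eqP; rewrite -(eqn_modDr 1) !addn1; apply/eqP/tour_inj.
      by rewrite Ei2 Ej2.
    by rewrite Ei3 Ej3.
  - by move=> Ez'; have := fadj z zy; rewrite Ez' (negPf zy').
  - by move=> _ Ez; have := fadj z' zy'; rewrite -E Ez (negPf zy).
  - by move=> -> ->.
exists (perm finj); split=> [i iy|].
  have iy' : dyck_adj (tour i) y by rewrite -iy tour_adj.
  rewrite permE; have := fP (tour i); rewrite iy' => -[j [Ej1 Ej2 <-]].
  have /eqP : j.+2 = i.+2 %[mod M].
    apply/eqP; rewrite -[j.+2]addn2 -[i.+2]addn2 eqn_modDr; apply/eqP.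
    by apply: tour_inj; rewrite ?iy.
  by move/eqP=> E; rewrite -tour_mod E tour_mod.
apply/subsetP => z; rewrite !inE permE; apply: contraR => yz.
by apply/eqP; have := fP z; rewrite dyck_sym (negPf yz).
Qed.

Variable R : V -> {perm V}.
Hypothesis R_tour : forall i, R (tour i.+1) (tour i) = tour i.+2.
Hypothesis R_on : forall y, perm_on [set z | dyck_adj y z] (R y).

(* Between two consecutive visits to y, the tour stays in one component of the
   complement of y, so it comes back through the neighbour by which it left. *)
Lemma dyck_porbit y z : dyck_adj y z -> porbit (R y) z = [set z' | dyck_adj y z'].
Proof.
move=> yz; have [_ dp _] := dyck_rooted.
have next m : forall i j, j <= i + m -> i <= j -> tour i.+1 = y -> tour j.+1 = y ->
    tour j \in porbit (R y) (tour i).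
  elim: m => [|m IH] i j jm ij Ei Ej.
    have -> : j = i by lia.
    exact: porbit_id.
  have [->|ne] := eqVneq j i; first exact: porbit_id.
  have lt : i.+2 <= j.+1 by lia.
  pose c := tour i.+2; have cE : c = R y (tour i) by rewrite -Ei R_tour.
  suff [k /andP[ik kj] [Ek1 Ek2]] : exists2 k, i.+2 <= k < j.+1 &
      tour k = c /\ tour k.+1 = y.
    have kj' : tour j \in porbit (R y) (tour k) by apply: IH => //; lia.
    have : porbit (R y) (tour k) = porbit (R y) (tour i).
      by apply/eqP; rewrite Ek1 cE eq_porbit_mem;
         have := mem_porbit (R y) 1 (tour i); rewrite expg1.
    by move=> <-.
  have := tour_adj i.+1; rewrite Ei -/c => /orP[/andP[c0 /eqP yE]|/andP[y0 /eqP cy]].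
    have [||k kij [Ek1 Ek2]] := exit_descendants dyck_rooted tour_adj lt (v := c).
    - exact: descendantxx.
    - by rewrite Ej descendantNlt // yE (dp _ c0).
    by exists k; rewrite // Ek1 Ek2 yE.
  have [||k kij [Ek1 Ek2]] := enter_descendants dyck_rooted tour_adj lt (v := y).
  - by rewrite -/c cy descendantNlt // (dp _ y0).
  - by rewrite Ej descendantxx.
  by exists k; rewrite // Ek1 Ek2 cy.
apply/eqP; rewrite eqEsubset; apply/andP; split; apply/subsetP => z'.
  case/porbitP=> k ->; rewrite inE; elim: k => [|k IH]; first by rewrite expg0 perm1.
  by rewrite expgSr permM; have := perm_closed ((R y ^+ k)%g z) (R_on y); rewrite !inE IH.
rewrite inE => yz'; rewrite dyck_sym in yz; rewrite dyck_sym in yz'.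
have [i [<- Ei]] := tour_surj yz; have [j [Ej1 Ej]] := tour_surj yz'.
(* One more period puts this visit after time [i]. *)
have -> : z' = tour (M + j) by rewrite -Ej1 -tour_mod -[RHS]tour_mod modnDl.
apply: (next (M + j - i)) => //; have := ltn_ord i; try lia.
by rewrite -addnS -tour_mod modnDl tour_mod.
Qed.

End DyckTree.

Section DyckCode.

Variables (n N : nat).
Hypothesis Nn : N.+1 = 2 * n.
Local Notation word := {ffun 'I_N.+1 -> bool}.
Local Notation V := 'I_n.+1.

Let n_gt0 : 0 < n. Proof. by case: n Nn. Qed.

Lemma dyck_word_has_code (w : word) : w \in balanced N n ->
  (forall k, k <= 2 * n -> k <= 2 * num_ups (per w) k) ->
  exists2 t : plane_structure n, is_plane_tree t & has_code t w.
Proof.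
move=> wb dyck; pose b := per w.
have b_period i : b (i %% (2 * n)) = b i.
  by rewrite -Nn; congr (w _); apply: val_inj; rewrite /= modn_mod.
have bM : num_ups b (2 * n) = n.
  rewrite -Nn; move: wb; rewrite inE => /eqP wb; rewrite -[RHS]wb.
  by apply: eq_bigr => i _; rewrite /b per_ord.
have /fin_all_exists[s sP] := exists_up_time n_gt0 bM.
pose e := dyck_adj b s; pose p := dyck_parent b s; pose d := dyck_depth b s.
have rooted : rooted_by e ord0 p d by apply: dyck_rooted.
have /fin_all_exists[R RP] := exists_dyck_rotation n_gt0 bM dyck sP.
pose x := tour b s.
have R_tour i : R (x i.+1) (x i) = x i.+2 by have [-> ] := RP (x i.+1).
have R_on y : perm_on [set z | e y z] (R y) by have [] := RP y.
have R_cycle : forall y z, e y z -> porbit (R y) z = [set z' | e y z'].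
  exact: (dyck_porbit n_gt0 bM dyck sP R_tour R_on).
have [dr dp eE] := rooted.
pose c v := [set p v; v].
have pne v : v != ord0 -> p v != v.
  by move=> v0; apply/eqP => E; have := dp v v0; rewrite E; lia.
have cinj : {in [set~ ord0] &, injective c}.
  move=> u v; rewrite !inE => ur vr /eq_set2[[_ //]|[E1 E2]].
  by have := dp _ ur; have := dp _ vr; rewrite E1 -E2; lia.
pose t : plane_structure n := ([set c v | v in [set~ ord0]], [ffun y => R y], ord0).
have tE u v : adjacent t u v = e u v.
  rewrite /adjacent /= eE; apply/imsetP/orP => [[z]|].
    by rewrite !inE => z0 /eq_set2[] [-> ->]; [left | right]; rewrite z0 eqxx.
  case=> /andP[v0 /eqP->]; [exists v | exists u]; rewrite ?inE //.
  by rewrite setUC.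
have rt : rooted_by (adjacent t) (root_vertex t) p d.
  by split=> // u v; rewrite tE eE.
have pt : is_plane_tree t.
  apply/andP; split; first apply/and3P; first split.
  - apply/forallP => a; apply/implyP => /imsetP[v]; rewrite !inE => v0 ->.
    by rewrite cards2 pne.
  - by apply/forallP => u; apply/forallP => v; exact: (rooted_connect rt).
  - by rewrite /edges /= card_in_imset // cardsC1 card_ord.
  apply/forallP => y; have nE : neighbours t y = [set z | e y z].
    by apply/setP => z; rewrite [LHS]inE [RHS]inE tE.
  rewrite nE /rotation ffunE R_on; apply/forallP => z; apply/implyP.
  by rewrite inE => yz; apply/eqP/R_cycle.
exists t => //; exists (x 1), p, d.
(* By [R_tour], tracing the face of the constructed tree reproduces the tour. *)
have xE i : tree_contour t (x 1) i = (x i, x i.+1).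
  elim: i => [|i IH]; first by rewrite /x /tour mod0n.
  rewrite /tree_contour /= -/(tree_contour t (x 1) i) IH /next_dart /=.
  by rewrite /rotation ffunE R_tour.
have wE i : tree_walker t (x 1) i = x i.
  by rewrite /tree_walker /walker -/(tree_contour _ _ _) xE.
split=> // [|i].
  rewrite tE; have := tour_adj n_gt0 bM dyck sP 0.
  by rewrite /tour mod0n.
by rewrite !wE; exact: (tour_up n_gt0 b_period bM dyck sP).
Qed.

Lemma exists_dyck_rotated (w : word) : w \in balanced N n ->
  exists2 w', w' \in rotations w &
    forall k, k <= 2 * n -> k <= 2 * num_ups (per w') k.
Proof.
move=> wb; pose b := per w; pose U := num_ups b.
have bN i : b (N.+1 + i) = b i by exact: per_period.
have UN : U N.+1 = n.
  move: wb; rewrite inE => /eqP wb; rewrite -[RHS]wb.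
  by apply: eq_bigr => i _; rewrite /b per_ord.
have UD i k : U (i + k) = U i + num_ups (fun j => b (i + j)) k.
  by rewrite /U /num_ups big_split_ord.
have UNk k : U (N.+1 + k) = n + U k.
  by rewrite UD UN; congr addn; apply: eq_bigr => j _; rewrite bN.
(* The height raised by 2n, which keeps the subtraction exact within a period. As in the cycle
   lemma, the word is restarted at a minimum. *)
pose G (k : nat) := 2 * U k + 2 * n - k.
pose k := [arg min_(k < (ord0 : 'I_N.+1)) G k].
have kmin j : j < N.+1 -> G k <= G j.
  by move=> jN; rewrite /k; case: arg_minnP => // i _ /(_ (Ordinal jN) isT).
exists (rotate w k); first by apply/imsetP; exists k.
move=> m mn; have -> : num_ups (per (rotate w k)) m = U (k + m) - U k.
  rewrite UD addKn; apply: eq_bigr => j _; rewrite per_rotate.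
  by rewrite addnC.
have kn := ltn_ord k.
have Ukm := num_ups_mono b (leq_addr m k); rewrite -!/(U _) in Ukm.
have [lt|ge] := ltnP (k + m) N.+1.
  by have := kmin _ lt; rewrite /G; lia.
have lt : k + m - N.+1 < N.+1 by lia.
(* A full period has n ups in 2n steps, so the height one period earlier is the same. *)
have := kmin _ lt; have := UNk (k + m - N.+1); rewrite subnKC // /G => E.
by rewrite E in Ukm *; lia.
Qed.

End DyckCode.

Local Open Scope ring_scope.

(** * Conclusion *)

(** On [D] the map [f] factors through [g]. Used both ways, it compares the numbers of classes of
    two maps with the same fibres. *)
Lemma leq_card_imset_ker (T U W : finType) (f : T -> U) (g : T -> W) (D : {set T}) :
  {in D &, forall x y, g x = g y -> f x = f y} -> (#|f @: D| <= #|g @: D|)%N.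
Proof.
move=> fg; have [->|[x0 x0D]] := set_0Vmem D; first by rewrite !imset0 !cards0.
pose h z := f (odflt x0 [pick x in D | g x == z]).
suff -> : f @: D = h @: (g @: D) by apply: leq_imset_card.
rewrite -imset_comp; apply: eq_in_imset => x xD; rewrite /= /h.
case: pickP => [y /andP[yD /eqP gy]|/(_ x)]; first by apply: fg; rewrite ?gy.
by rewrite /= xD eqxx.
Qed.

Lemma num_plane_trees_necklaces n N : N.+1 = (2 * n)%N ->
  num_plane_trees n = #|[set rotations w | w in balanced N n]|.
Proof.
move=> Nn; pose S := [set t : plane_structure n | is_plane_tree t].
have /fin_all_exists[W WP] : forall t : plane_structure n,
    exists w : {ffun 'I_N.+1 -> bool}, is_plane_tree t -> has_code t w.
  move=> t; have [pt|pt] := boolP (is_plane_tree t).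
    by have [w tw] := has_code_exists Nn pt; exists w.
  by exists [ffun=> false].
have -> : [set rotations w | w in balanced N n] = (fun t => rotations (W t)) @: S.
  apply/setP => O; apply/imsetP/imsetP => [[w wb ->]|[t]]; last first.
    rewrite inE => pt ->; exists (W t) => //.
    exact: (has_code_balanced Nn pt (WP t pt)).
  have [w' w'w dyck] := exists_dyck_rotated Nn wb.
  have w'b : w' \in balanced N n.
    case/imsetP: w'w => k _ ->; rewrite inE sum_rotate.
    by move: wb; rewrite inE.
  have [t pt tw'] := dyck_word_has_code Nn w'b dyck.
  exists t; first by rewrite inE.
  move: w'w; rewrite -rotations_eq => /eqP->; apply/eqP; rewrite rotations_eq.
  exact: (has_code_rotation Nn pt tw' (WP t pt)).
have equiv := @plane_iso_equivalence n.
have iso_refl (t : plane_structure n) : plane_iso t t by have [] := equiv t t t.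
(* Two plane trees are isomorphic exactly when their chosen codes are rotations of each other. *)
have ker : {in S &, forall t u,
    ([set v in S | plane_iso t v] = [set v in S | plane_iso u v]) <->
    rotations (W t) = rotations (W u)}.
  move=> t u; rewrite !inE => pt pu; split=> [|/eqP].
    move/setP/(_ u); rewrite !inE pu iso_refl /= => tu.
    have ut := has_code_iso pt tu (WP t pt).
    by apply/eqP; rewrite rotations_eq (has_code_rotation Nn pu ut (WP u pu)).
  rewrite rotations_eq => /(has_code_rotate Nn pt pu (WP t pt) (WP u pu)) tu.
  have iso := same_code_iso Nn pt pu tu (WP u pu).
  by apply/setP => v; rewrite !inE; have [_ /(_ iso) ->] := equiv t u v.
apply/eqP; rewrite eqn_leq /num_plane_trees /equivalence_partition; apply/andP.
by split; apply: leq_card_imset_ker => t u tS uS; apply ker.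
Qed.

Lemma num_bridges_dvd_plane_trees n : (0 < n)%N ->
  num_bridges_dvd half_step n = (2 * num_plane_trees n)%N.
Proof.
move=> n0; have Nn : (2 * n).-1.+1 = (2 * n)%N by lia.
rewrite (num_plane_trees_necklaces Nn); apply/eqP; rewrite -(eqn_pmul2l n0).
by rewrite num_bridges_dvdE // -(num_necklaces Nn) mulnC -mulnA mulnCA.
Qed.

Unset Implicit Arguments.

Theorem proposition7 (Bstar : nat -> rat)
    (hB : levy_khintchine (fun n => (num_graphical_bridges n)%:R) Bstar)
    (n : nat) (hn : (1 <= n)%N) :
  Bstar n = 2 * (num_plane_trees n)%:R.
Proof.
(* It remains to check the recursion of the transform for twice the number of trees. *)
apply: (levy_khintchine_unique (b := fun n => 2 * (num_plane_trees n)%:R) hB _ hn).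
move=> {n hn}.
apply/levy_khintchine_recursion; split=> [|n n0].
  by rewrite num_graphical_bridges0.
rewrite -natrM num_graphical_bridgesE (num_graphical_rec half_step_le1) natr_sum.
rewrite big_add1 big_mkord (reindex_inj rev_ord_inj); apply: eq_bigr => i _ /=.
have -> : (n - (n - i.+1) = i.+1)%N by have := ltn_ord i; lia.
by rewrite num_bridges_dvd_plane_trees // !natrM mulrC num_graphical_bridgesE.
Qed.
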